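(* Let $\mathbf{k}$ be a field of characteristic zero and fix integers $n,k\ge 2$. Then for general linear forms $\ell_1,\dots,\ell_{n+1}\in\mathbf{k}[x_1,\dots,x_n]$, the algebra $\mathbf{k}[x_1,\dots,x_n]/(\ell_1^2,\dots,\ell_n^2,\ell_{n+1}^k)$ has the weak Lefschetz property if and only if $$\begin{cases}k\ge \frac{n-3}{2} & \text{for } n \text{ odd},\\ k\ge \frac{n}{2} & \text{for } n \text{ even}.\end{cases}$$
   Context: An Artinian standard graded algebra $A$ has the weak Lefschetz property (WLP) if there exists a linear form $\ell$ such that the multiplication map $\cdot\ell:A_i\to A_{i+1}$ has maximal rank (is injective or surjective) for all $i$. ''General linear forms'' means that the coefficient vector of $(\ell_1,\dots,\ell_{n+1})$ lies in a suitable non-empty Zariski open subset of the space of all such tuples. *)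

(* Defs.v *)
From HB Require Import structures.
From mathcomp Require Import all_boot all_order all_algebra.
From mathcomp Require Import generic_quotient ring_quotient mpoly.
From mathcomp Require boolp.

Set Implicit Arguments.
Unset Strict Implicit.
Unset Printing Implicit Defensive.

Import GRing.Theory.
Local Open Scope ring_scope.
Local Open Scope quotient_scope.

(* Boolean-valued (by classical logic) because the library quotient            *)
(* {ideal_quot I} requires a boolean predicate I.                              *)
Definition gen_by (R : comNzRingType) (m : nat) (g : 'I_m -> R) : {pred R} :=
  fun p => boolp.asbool (exists c : 'I_m -> R, p = \sum_(i < m) c i * g i).

Lemma gen_byP (R : comNzRingType) (m : nat) (g : 'I_m -> R) (p : R) :
  reflect (exists c : 'I_m -> R, p = \sum_(i < m) c i * g i) (p \in gen_by g).
Proof. exact: boolp.asboolP. Qed.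

(* {ideal_quot I} is only available for proper ideals, hence the proof         *)
(* argument.                                                                   *)
Definition gen_ideal (R : comNzRingType) (m : nat) (g : 'I_m -> R)
  of 1 \notin gen_by g : {pred R} := gen_by g.

Lemma gen_ideal_closed (R : comNzRingType) (m : nat) (g : 'I_m -> R)
  (g_proper : 1 \notin gen_by g) : idealr_closed (gen_ideal g_proper).
Proof.
split=> //; first by apply/gen_byP; exists (fun=> 0); rewrite big1 // => i; rewrite mul0r.
move=> a _ _ /gen_byP[c ->] /gen_byP[d ->]; apply/gen_byP.
exists (fun i => a * c i + d i); rewrite mulr_sumr -big_split /=.
by apply: eq_bigr => i _; rewrite mulrDl mulrA.
Qed.

HB.instance Definition _ (R : comNzRingType) (m : nat) (g : 'I_m -> R)
    (g_proper : 1 \notin gen_by g) :=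
  isIdealr.Build R (gen_ideal g_proper) (gen_ideal_closed g_proper).

Definition is_ideal (A : comNzRingType) (J : A -> Prop) : Prop :=
  [/\ J 0, forall x y, J x -> J y -> J (x + y) & forall a x, J x -> J (a * x)].

Definition artinian (A : comNzRingType) : Prop :=
  forall J : nat -> A -> Prop,
    (forall i, is_ideal (J i)) ->
    (forall i x, J i.+1 x -> J i x) ->
    exists N, forall i, (N <= i)%N -> forall x, J i x <-> J N x.

(* gr d is the homogeneous component A_d of the graded ring A.                 *)
Definition weak_Lefschetz (A : comNzRingType) (gr : nat -> A -> Prop) : Prop :=
  exists2 ell : A, gr 1%N ell &
    forall i : nat,
      (forall x y, gr i x -> gr i y -> ell * x = ell * y -> x = y) \/
      (forall z, gr i.+1 z -> exists2 x, gr i x & ell * x = z).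

(* Row i of L is the coefficient vector of the i-th linear form.               *)
Definition lform (K : fieldType) (m n : nat) (L : 'M[K]_(m, n)) (i : 'I_m) :
  {mpoly K[n]} := \sum_(j < n) L i j *: 'X_j.

Definition gens (K : fieldType) (n k : nat) (L : 'M[K]_(n.+1, n)) (i : 'I_n.+1) :
  {mpoly K[n]} := lform L i ^+ (if i == ord_max then k else 2).

Lemma gens_proper (K : fieldType) (n k : nat) (L : 'M[K]_(n.+1, n)) :
  (2 <= k)%N -> 1 \notin gen_by (gens k L).
Proof.
move=> k2; apply/gen_byP => -[c /(congr1 (meval (fun=> 0)))].
rewrite rmorph1 rmorph_sum /= big1 => [/eqP|i _]; first by rewrite oner_eq0.
rewrite rmorphM rmorphXn /= (_ : (lform L i).@[fun=> 0] = 0).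
  by rewrite expr0n; case: ifP => _; rewrite ?mulr0 //; case: k k2 => //= k' _; rewrite mulr0.
by rewrite rmorph_sum /= big1 // => j _; rewrite mevalZ mevalXU mulr0.
Qed.

Definition quot_alg (K : fieldType) (n k : nat) (k2 : (2 <= k)%N)
  (L : 'M[K]_(n.+1, n)) : comNzRingType :=
  {ideal_quot (gen_ideal (gens_proper L k2))}.

Definition quot_gr (K : fieldType) (n k : nat) (k2 : (2 <= k)%N)
  (L : 'M[K]_(n.+1, n)) (d : nat) (x : quot_alg k2 L) : Prop :=
  exists2 p : {mpoly K[n]}, p \is d.-homog &
    x = \pi_({ideal_quot (gen_ideal (gens_proper L k2))}) p.

(* The coordinates of the affine space of m x n matrices are the entries,      *)
(* numbered by mxvec.                                                          *)
Definition zariski_open (K : fieldType) (m n : nat) (U : 'M[K]_(m, n) -> Prop) :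
  Prop :=
  exists S : {mpoly K[m * n]} -> Prop, forall L : 'M[K]_(m, n),
    U L <-> exists2 f, S f & f.@[fun i => mxvec L 0 i] != 0.

Definition for_general (K : fieldType) (m n : nat) (P : 'M[K]_(m, n) -> Prop) :
  Prop :=
  exists U : 'M[K]_(m, n) -> Prop,
    [/\ zariski_open U, exists L, U L & forall L, U L -> P L].

(* Main.v *)
(* Write n = 2m + r - 1 with r = 1 or 2.  After a linear change of variables
   the algebra is B/(l^k), where B = K[x]/(x_1^2, ..., x_n^2) and
   l = x_1 + ... + x_n.  Let L = sum a_i x_i with the a_i distinct and nonzero.

   L and the lowering operator with weights 1/a_i generate an action of sl_2 on
   B, so powers of L are injective, resp. surjective, on B in the expected
   degrees; a = 1 gives the same for l.  In degrees >= m multiplication by L is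
   thus surjective.  Below, it is injective on B/(l^k) as soon as l^k g in L B
   forces g in L B for deg g <= r - 1.  This holds for k > m - r: a
   matching of the indices defines a ring morphism x_i -> a_j y, x_j -> - a_i y
   on the pairs {i, j}, which kills L, and these morphisms detect l^k g.

   For 2 <= k <= m - r multiplication by L from degree m - 1 to degree m is not
   surjective, because a determinant of Vandermonde type is a multilinear form of
   degree m killed by the derivation along a and by the square of the one along
   (1, ..., 1).  It is not injective either: l^(m+r) = L^(r+1) u for some u, and
   lowering r times turns this into l^(m-r) q = L f with q of degree r, where
   f in (l^k) would give l^(m-r-k) q in L B, which matchings exclude.

   These failures extend from distinct nonzero a_i to all a, since injectivity
   and surjectivity are open conditions on the line through two linear forms. *)
From HB Require Import structures.
Require Import Defs.
From mathcomp Require Import all_boot all_order all_algebra.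
From mathcomp Require Import fingroup perm generic_quotient ring_quotient ssrcomplements mpoly.
From mathcomp Require Import ring zify.
From mathcomp Require boolp.

Set Implicit Arguments.
Unset Strict Implicit.
Unset Printing Implicit Defensive.

Import Order.TTheory GRing.Theory Num.Theory.
Local Open Scope ring_scope.

(** * The ideal of the squares of the variables *)

Section SquareIdeal.
Variables (K : fieldType) (n : nat).
Implicit Types (p q : {mpoly K[n]}) (a b c t : 'I_n -> K) (mu : 'X_{1..n}).

Definition lin a : {mpoly K[n]} := \sum_(i < n) a i *: 'X_i.

Lemma lin_homog a : lin a \is 1.-homog.
Proof. by apply: rpred_sum => i _; apply: rpredZ; rewrite dhomogX /= mdeg1. Qed.

Lemma homog1_lin p : p \is 1.-homog -> exists a, p = lin a.
Proof.
move=> hp; exists (fun i => p@_(U_(i))); apply/mpolyP => mu.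
rewrite raddf_sum /=; under eq_bigr do rewrite mcoeffZ mcoeffX.
have [/mdeg1P[i /eqP ->]|mu1] := boolP (mdeg mu == 1%N).
  rewrite (bigD1 i) //= eqxx mulr1 big1 ?addr0 // => j ji.
  by rewrite eq_mnm1 (negPf ji) mulr0.
rewrite (dhomog_nemf_coeff hp mu1) big1 // => i _.
by case: eqP => [ei|_]; rewrite ?mulr0 //; case/negP: mu1; rewrite -ei mdeg1.
Qed.

Lemma linD a b : lin a + lin b = lin (fun i => a i + b i).
Proof. by rewrite -big_split /=; apply: eq_bigr => i _; rewrite scalerDl. Qed.

Lemma linZ x a : x *: lin a = lin (fun i => x * a i).
Proof. by rewrite scaler_sumr; apply: eq_bigr => i _; rewrite scalerA. Qed.

Lemma lin_homogM a p d : p \is d.-homog -> lin a * p \is d.+1.-homog.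
Proof. by move=> hp; rewrite -add1n; apply: dhomogM => //; apply: lin_homog. Qed.

Lemma lin_homogX a p d k : p \is d.-homog -> lin a ^+ k * p \is (k + d).-homog.
Proof.
by move=> hp; apply: dhomogM => //; rewrite -[k in k.-homog]mul1n; apply/dhomogMn/lin_homog.
Qed.

Definition squarefree mu := forall i, (mu i <= 1)%N.

(* The ideal (x_1^2, ..., x_n^2), see in_squaresP. *)
Definition in_squares p := forall mu, squarefree mu -> p@_mu = 0.

Lemma in_squares0 : in_squares 0.
Proof. by move=> mu _; rewrite mcoeff0. Qed.

Lemma in_squaresD p q : in_squares p -> in_squares q -> in_squares (p + q).
Proof. by move=> sp sq mu hmu; rewrite mcoeffD sp ?sq ?addr0. Qed.

Lemma in_squaresN p : in_squares p -> in_squares (- p).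
Proof. by move=> sp mu hmu; rewrite mcoeffN sp ?oppr0. Qed.

Lemma in_squaresB p q : in_squares p -> in_squares q -> in_squares (p - q).
Proof. by move=> sp sq; apply/in_squaresD/in_squaresN. Qed.

Lemma in_squaresM p q : in_squares q -> in_squares (p * q).
Proof.
move=> sq mu hmu; rewrite mcoeffM big1 // => m /eqP em.
rewrite sq ?mulr0 // => i; apply: leq_trans (hmu i).
by have -> : mu i = (m.1 i + m.2 i)%N; [rewrite -mnmDE -em | rewrite leq_addl].
Qed.

Lemma in_squaresZ x p : in_squares p -> in_squares (x *: p).
Proof. by rewrite -mul_mpolyC; apply: in_squaresM. Qed.

Lemma in_squaresZr x p : x != 0 -> in_squares (x *: p) -> in_squares p.
Proof.
by move=> x0 /(in_squaresZ x^-1); rewrite scalerA mulVf // scale1r.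
Qed.

Lemma in_squares_sum (I : finType) (F : I -> {mpoly K[n]}) :
  (forall i, in_squares (F i)) -> in_squares (\sum_i F i).
Proof. by move=> h; elim/big_ind: _ => // [|????]; [apply: in_squares0|apply: in_squaresD]. Qed.

(** A squarefree monomial in n variables has degree at most n. *)
Lemma in_squares_homog_gt p d : p \is d.-homog -> (n < d)%N -> in_squares p.
Proof.
move=> hp nd mu hmu; apply: (dhomog_nemf_coeff hp).
rewrite /= neq_ltn mdegE (leq_ltn_trans _ nd) //.
by rewrite -[n in (_ <= n)%N]card_ord -sum1_card; apply: leq_sum => i _; apply: hmu.
Qed.

Lemma mcoeff_XM i p mu : ('X_i * p)@_mu = if mu i == 0%N then 0 else p@_(mu - U_(i)).
Proof.
case: ifPn => [/eqP mui|mui]; last first.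
  rewrite mulrC -[mu in LHS](@submK _ U_(i)) ?lep1mP //.
  by rewrite [X in _@_X]addmC mcoeffMX.
apply: memN_msupp_eq0; rewrite mulrC (perm_mem (msuppMX _ _)).
by apply/mapP => -[nu _ e]; move: mui; rewrite e mnmDE mnm1E eqxx.
Qed.

Lemma mcoeff_linM a p mu :
  (lin a * p)@_mu = \sum_(i | mu i != 0%N) a i * p@_(mu - U_(i)).
Proof.
rewrite /lin mulr_suml raddf_sum /= [RHS]big_mkcond /=; apply: eq_bigr => i _.
by rewrite -scalerAl mcoeffZ mcoeff_XM; case: (mu i == 0%N); rewrite ?mulr0.
Qed.

Lemma in_squaresXX i : in_squares ('X_i ^+ 2).
Proof.
move=> mu hmu; rewrite expr2 mcoeff_XM; case: ifP => // _.
rewrite mcoeffX; case: eqP => // e; have := hmu i.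
have := congr1 (fun m : 'X_{1..n} => m i) e.
by rewrite mnmBE mnm1E eqxx /=; case: (mu i) => [|[|]].
Qed.

Lemma in_squaresP p :
  in_squares p <-> exists c : 'I_n -> {mpoly K[n]}, p = \sum_i c i * 'X_i ^+ 2.
Proof.
split=> [sp|[c ->]]; last by apply: in_squares_sum => i; apply/in_squaresM/in_squaresXX.
rewrite [p]mpolyE big_seq.
elim/big_ind: _ => [|_ _ [c ->] [d ->]|mu].
- by exists (fun=> 0); rewrite big1 // => i _; rewrite mul0r.
- by exists (fun i => c i + d i); rewrite -big_split; apply: eq_bigr => i _; rewrite mulrDl.
rewrite mcoeff_msupp => pmu.
have /existsP[i mui] : [exists i, (1 < mu i)%N].
  apply: contraNT pmu; rewrite negb_exists => /forallP hmu.
  by apply/eqP/sp => i; rewrite leqNgt hmu.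
exists (fun j => if j == i then p@_mu *: 'X_[mu - (U_(i) + U_(i))] else 0).
rewrite (bigD1 i) //= eqxx big1 ?addr0 => [|j /negPf ->]; last by rewrite mul0r.
rewrite expr2 -scalerAl -!mpolyXD submK //.
apply/mnm_lepP => j; rewrite mnmDE mnm1E; case: eqP => [<-|] //.
Qed.

(* On squarefree monomials this is d/dx_i; the second order term makes it
   preserve the ideal of the squares, and the sl_2 relations exact. *)
Definition sqderiv i p := p^`M(i) - 'X_i * p^`M(i)^`M(i).

(** At a squarefree [mu] with exponent 0 at i, the coefficient involves only [mu + U_(i)], which is
    still squarefree. With exponent 1, both terms contribute twice the coefficient of p at
    [mu + U_(i)] and cancel. *)
Lemma in_squares_sqderiv i p : in_squares p -> in_squares (sqderiv i p).
Proof.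
move=> sp mu hmu; rewrite mcoeffB mcoeff_XM !mcoeff_deriv; case: eqP => mui.
  have muU : squarefree (mu + U_(i)).
    by move=> j; rewrite mnmDE mnm1E; case: eqP => [<-|_]; rewrite ?mui ?addn0.
  by rewrite sp // mul0rn subr0.
have {mui} mui : mu i = 1%N by apply/eqP; rewrite eqn_leq hmu lt0n; apply/eqP.
have -> : (mu - U_(i) + U_(i) = mu)%MM by rewrite submK // lep1mP mui.
by rewrite mnmBE mnm1E eqxx mui /= mulr1n subrr.
Qed.

Definition lower t p := \sum_i t i *: sqderiv i p.

Lemma in_squares_lower t p : in_squares p -> in_squares (lower t p).
Proof. by move=> sp; apply: in_squares_sum => i; apply/in_squaresZ/in_squares_sqderiv. Qed.

Lemma lower_is_linear t : linear (lower t).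
Proof.
move=> x p q; rewrite /lower scaler_sumr -big_split /=; apply: eq_bigr => i _.
rewrite /sqderiv !mderivD !mderivZ mulrDr -scalerAr opprD addrACA -scalerBr.
by rewrite scalerDr !scalerA mulrC.
Qed.

HB.instance Definition _ t :=
  GRing.isLinear.Build K {mpoly K[n]} {mpoly K[n]} _ (lower t) (lower_is_linear t).

Lemma mderiv_homog i p d : p \is d.+1.-homog -> p^`M(i) \is d.-homog.
Proof.
move=> hp; apply/dhomogP => mu; rewrite mcoeff_msupp mcoeff_deriv => h.
apply/eqP; move: h; apply: contraNT => hd.
rewrite (dhomog_nemf_coeff hp) ?mul0rn //.
by rewrite /= mdegD mdeg1 addn1 eqSS.
Qed.

Lemma mderiv_homog0 i p : p \is 0.-homog -> p^`M(i) = 0.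
Proof.
move=> hp; apply/mpolyP => mu; rewrite mcoeff_deriv (dhomog_nemf_coeff hp) ?mul0rn ?mcoeff0 //=.
by rewrite mdegD mdeg1 addn1.
Qed.

Lemma lower_homog t p d : p \is d.+1.-homog -> lower t p \is d.-homog.
Proof.
move=> hp; apply: rpred_sum => i _; apply/rpredZ/rpredB; first exact: mderiv_homog.
have := mderiv_homog i hp; case: d {hp} => [|d] h.
  by rewrite mderiv_homog0 // mulr0 dhomog0.
by rewrite -add1n; apply: dhomogM; [rewrite dhomogX /= mdeg1 | apply: mderiv_homog].
Qed.

Lemma lower_homog0 t p : p \is 0.-homog -> lower t p = 0.
Proof.
move=> hp; rewrite /lower big1 // => i _.
by rewrite /sqderiv mderiv_homog0 // linear0 mulr0 subrr scaler0.
Qed.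

Lemma mderivXU i j : ('X_j)^`M(i) = (i == j)%:R%:MP :> {mpoly K[n]}.
Proof.
rewrite mderivX mnm1E eq_sym; case: eqP => [->|_]; last by rewrite scale0r mpolyC0.
by rewrite scale1r -[in X in (X - _)%MM](add0m U_(j)%MM) addmK mpolyX0 mpolyC1.
Qed.

Lemma mderiv_lin a i : (lin a)^`M(i) = (a i)%:MP.
Proof.
rewrite /lin linear_sum /= (bigD1 i) //= big1 => [|j ji]; rewrite mderivZ mderivXU.
  by rewrite eqxx addr0 -mul_mpolyC mpolyC1 mulr1.
by rewrite eq_sym (negPf ji) mpolyC0 scaler0.
Qed.
End SquareIdeal.

(** * Lefschetz properties of linear forms modulo squares *)

Section LefschetzTriple.
Variables (K : fieldType) (n : nat).
Hypothesis charK0 : [pchar K] =i pred0.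
Implicit Types (p q u v : {mpoly K[n]}) (a b c t : 'I_n -> K).

Lemma natf_eq0 m : (m%:R == 0 :> K) = (m == 0)%N.
Proof. exact: (pcharf0P K).1. Qed.

Lemma sqderiv_linM a i p :
  sqderiv i (lin a * p) = lin a * sqderiv i p + a i *: p - a i *: ('X_i * p^`M(i)) *+ 2.
Proof.
rewrite /sqderiv !mderivM !mderivD !mderivM !mderiv_lin mderivC -!mul_mpolyC; ring.
Qed.

Lemma euler_homog p d : p \is d.-homog -> \sum_i 'X_i * p^`M(i) = d%:R *: p.
Proof.
move=> hp; apply/mpolyP => mu; rewrite raddf_sum mcoeffZ /=.
transitivity ((mdeg mu)%:R * p@_mu); last first.
  by have [->//|md] := eqVneq (mdeg mu) d; rewrite (dhomog_nemf_coeff hp md) !mulr0.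
rewrite mdegE natr_sum mulr_suml; apply: eq_bigr => i _.
rewrite mcoeff_XM; case: eqP => [->|/eqP mui]; first by rewrite mul0r.
rewrite mcoeff_deriv submK ?lep1mP // mnmBE mnm1E eqxx /= subn1 prednK ?lt0n //.
by rewrite mulr_natl.
Qed.

(** The sl_2 relation: Euler's identity turns the sum of the commutators [sqderiv_linM] into the
    weight n - 2d. It holds in the polynomial ring itself, before reducing modulo squares. *)
Lemma lower_linM a t p d : (forall i, t i * a i = 1) -> p \is d.-homog ->
  lower t (lin a * p) = lin a * lower t p + (n%:R - (2 * d)%:R) *: p.
Proof.
move=> ta hp.
transitivity (lin a * lower t p + \sum_i (p - 'X_i * p^`M(i) *+ 2)).
  rewrite /lower mulr_sumr -big_split /=; apply: eq_bigr => i _.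
  by rewrite sqderiv_linM -!scalerAr -addrA scalerDr scalerBr scalerMnr !scalerA ta !scale1r.
congr (_ + _); rewrite big_split sumrN /= sumr_const card_ord sumrMnl (euler_homog hp).
by rewrite scalerBl natrM -scalerA !scaler_nat.
Qed.

(** The constant is the sum of the weights n - 2d - 2i for i from 0 to j. *)
Lemma lower_linX a t p d j : (forall i, t i * a i = 1) -> p \is d.-homog ->
  lower t (lin a ^+ j.+1 * p) = lin a ^+ j.+1 * lower t p
    + (j.+1%:R * (n%:R - (2 * d + j)%:R)) *: (lin a ^+ j * p).
Proof.
move=> ta hp; elim: j => [|j IHj].
  by rewrite !expr1 expr0 mul1r addn0 mul1r; apply: lower_linM.
rewrite exprS -mulrA (lower_linM ta (lin_homogX a j.+1 hp)) IHj.
rewrite mulrDr mulrA -exprS -scalerAr [lin a * (_ * p)]mulrA -exprS -addrA -scalerDl.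
congr (_ + _ *: _); rewrite !(natrD, natrM) -!natr1; ring.
Qed.

Lemma natrB_neq0 (c m : nat) : (m < c)%N -> c%:R - m%:R != 0 :> K.
Proof. by move=> h; rewrite -natrB 1?ltnW // natf_eq0 subn_eq0 -ltnNge. Qed.

Section Duality.
Variables (a t : 'I_n -> K).
Hypothesis ta : forall i, t i * a i = 1.

(** On a primitive element, lowering strips one factor of the power and leaves a scalar (k + 1)(n -
    2d - k), which is nonzero in this range of degrees. *)
Lemma lin_inj_primitive p d k : p \is d.-homog -> (2 * d + k <= n)%N ->
  in_squares (lower t p) -> in_squares (lin a ^+ k * p) -> in_squares p.
Proof.
move=> hp + lp; elim: k => [|k IHk] dk; first by rewrite expr0 mul1r.
move/(in_squares_lower t); rewrite (lower_linX _ ta hp) => sq.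
have := in_squaresB sq (in_squaresM (lin a ^+ k.+1) lp).
rewrite addrC addKr => /in_squaresZr h; apply: IHk; first by rewrite addnS in dk; apply: ltnW.
by apply: h; rewrite mulf_neq0 ?natf_eq0 // natrB_neq0 // -addnS.
Qed.

(* Half of the hard Lefschetz property of K[x]/(x_i^2): the lowering operator
   trades degree against the exponent, down to primitive elements. *)
Lemma lin_inj p d k : p \is d.-homog -> (2 * d + k <= n)%N ->
  in_squares (lin a ^+ k * p) -> in_squares p.
Proof.
elim: d p k => [|d IHd] p k hp dk sq; apply: (lin_inj_primitive hp dk _ sq).
  by rewrite lower_homog0 //; apply: in_squares0.
apply: (IHd _ k.+1); [exact: lower_homog|lia|].
have sq' : in_squares (lin a ^+ k.+1 * p) by rewrite exprS -mulrA; apply: in_squaresM.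
move/(in_squares_lower t): sq'; rewrite (lower_linX _ ta hp).
move/in_squaresB/(_ (in_squaresZ (k.+1%:R * (n%:R - (2 * d.+1 + k)%:R)) sq)).
by rewrite addrK.
Qed.

(** Modulo squares, v is a highest weight vector, and raising undoes one lowering up to the usual
    scalar, the sum of the weights 2(d - j) - n for j from 0 to i. *)
Lemma lower_lin_highest v d i : v \is d.-homog -> (i < d)%N -> in_squares (lin a * v) ->
  in_squares (lin a * iter i.+1 (lower t) v
    - (i.+1%:R * ((2 * d)%:R - (n + i)%:R)) *: iter i (lower t) v).
Proof.
move=> hv + sq.
have hit j : (j <= d)%N -> iter j (lower t) v \is (d - j).-homog.
  elim: j => [|j IHj] jd; first by rewrite subn0.
  by apply: lower_homog; rewrite -subSn //=; apply/IHj/ltnW.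
have step j : (j <= d)%N -> lin a * iter j.+1 (lower t) v = lower t (lin a * iter j (lower t) v)
    - (n%:R - (2 * (d - j))%:R) *: iter j (lower t) v.
  by move=> jd; rewrite (lower_linM ta (hit _ jd)) addrK.
elim: i => [|i IHi] id; rewrite step //; last exact: ltnW.
  rewrite -addrA -opprD -scalerDl mul1r subn0 addn0.
  have -> : n%:R - (2 * d)%:R + ((2 * d)%:R - n%:R) = 0 :> K by ring.
  by rewrite scale0r oppr0 addr0; apply: in_squares_lower.
have {IHi} := in_squares_lower t (IHi (ltnW id)).
rewrite linearB linearZ /=; set x := i.+1%:R * _ => h.
rewrite -addrA -opprD -scalerDl.
have -> // : n%:R - (2 * (d - i.+1))%:R + i.+2%:R * ((2 * d)%:R - (n + i.+1)%:R) = x.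
rewrite /x mulnBr natrB ?leq_mul2l //; last exact: ltnW.
by rewrite !natrM !natrD -!natr1; ring.
Qed.

(* The other half: descending induction on the degree reduces to elements killed
   by the form, which lower_lin_highest writes as multiples of its powers. *)
Lemma lin_surj v d k : v \is (d + k).-homog -> (n <= 2 * d + k)%N ->
  exists2 u, u \is d.-homog & in_squares (v - lin a ^+ k * u).
Proof.
move: {2}(n.+1 - (d + k))%N (leqnn (n.+1 - (d + k))) => N; elim: N k v => [|N IHN] k v hN hv dk.
  (* Here d + k exceeds n, so v itself lies in the ideal of the squares. *)
  exists 0; rewrite ?dhomog0 // mulr0 subr0.
  by apply: (in_squares_homog_gt hv); lia.
have [|||u' hu' sq'] := IHN k.+1 (lin a * v); [lia|by rewrite addnS; apply: lin_homogM|lia|].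
set w := v - lin a ^+ k * u'.
have hw : w \is (d + k).-homog by rewrite rpredB // addnC lin_homogX.
have sqw : in_squares (lin a * w) by rewrite mulrBr mulrA -exprS.
suff [x sx] : exists x, in_squares (w - x *: (lin a ^+ k * iter k (lower t) w)).
  exists (u' + x *: iter k (lower t) w).
    apply: rpredD => //; apply: rpredZ.
    have hit j : (j <= k)%N -> iter j (lower t) w \is (d + k - j).-homog.
      elim: j => [|j IHj] jd; first by rewrite subn0.
      by apply: lower_homog; rewrite -subSn ?ltn_addl //=; apply/IHj/ltnW.
    by have := hit k (leqnn k); rewrite addnK.
  by rewrite mulrDr opprD addrA -scalerAr.
(* Only the two exponents k are generalised to i, so that the degree d + k of w stays fixed during
   the induction. *)
have [i ik] : exists i, i = k by exists k.
rewrite -[in lin a ^+ k]ik -[in iter k]ik; have : (i <= k)%N by rewrite ik.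
elim: i {ik} => [|i IHi] ik.
  by exists 1; rewrite expr0 mul1r scale1r subrr; apply: in_squares0.
have [x sx] := IHi (ltnW ik).
have dgt : (n + i < 2 * (d + k))%N by lia.
set y := i.+1%:R * ((2 * (d + k))%:R - (n + i)%:R) : K.
have y0 : y != 0 by rewrite mulf_neq0 ?natf_eq0 // natrB_neq0.
exists (x / y).
have := in_squaresZ (x / y) (in_squaresM (lin a ^+ i) (lower_lin_highest hw (ltn_addl d ik) sqw)).
move/(in_squaresB sx); congr in_squares; rewrite -/y mulrBr scalerBr mulrA -exprSr.
by rewrite -scalerAr scalerA divfK //; ring.
Qed.

(** Lowering a multiple of a power of [lin a] costs a single factor; this is how relations are
    lowered when injectivity is refuted. *)
Lemma lower_linX_multiple u d j : u \is d.-homog ->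
  exists2 u', u' \is d.-homog & lower t (lin a ^+ j.+1 * u) = lin a ^+ j * u'.
Proof.
move=> hu; exists (lin a * lower t u + (j.+1%:R * (n%:R - (2 * d + j)%:R)) *: u).
  apply: rpredD; last exact: rpredZ.
  by case: d hu => [|d] hu; [rewrite lower_homog0 // mulr0 dhomog0 | apply/lin_homogM/lower_homog].
rewrite (lower_linX _ ta hu); set x := _%:R * _.
by rewrite mulrDr mulrA -exprSr -scalerAr.
Qed.
End Duality.
End LefschetzTriple.

(** * Contraction along a matching *)

Section Contraction.
Variables (K : fieldType) (n M : nat) (a : 'I_n -> K) (e o : 'I_M -> 'I_n).
Hypotheses (e_inj : injective e) (o_inj : injective o) (eo : forall p q, e p != o q).
Hypothesis a_eo : forall p, a (o p) != a (e p).

(** Unmatched variables are sent to 0. The denominator normalises the images of the two variables of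
    a pair to have sum the variable p. *)
Let weight (i : 'I_n) (p : 'I_M) : K :=
  ((i == e p)%:R * a (o p) - (i == o p)%:R * a (e p)) / (a (o p) - a (e p)).

(* The ring morphism pairing the variables e p and o p into one variable, so
   that lin a is sent to 0 and the sum of all variables to the same sum. *)
Definition contract (p : {mpoly K[n]}) : {mpoly K[M]} :=
  mmap (mpolyC M (R := K)) (fun i => lin (weight i)) p.

HB.instance Definition _ := GRing.RMorphism.copy contract
  (mmap (mpolyC M (R := K)) (fun i => lin (weight i))).

Lemma contractZ x p : contract (x *: p) = x *: contract p.
Proof. by rewrite /contract mmapZ mul_mpolyC. Qed.

Lemma contract_lin c : contract (lin c) =
  lin (fun p => (c (e p) * a (o p) - c (o p) * a (e p)) / (a (o p) - a (e p))).
Proof.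
rewrite /lin raddf_sum /=.
under eq_bigr => i _ do rewrite contractZ /contract mmapX mmap1U /lin scaler_sumr.
rewrite exchange_big /=; apply: eq_bigr => p _.
under eq_bigr do rewrite scalerA; rewrite -scaler_suml; congr (_ *: _).
under eq_bigr do rewrite mulrA mulrBr; rewrite -mulr_suml sumrB; congr ((_ - _) / _).
  rewrite (bigD1 (e p)) //= eqxx mul1r big1 ?addr0 // => i /negPf ->.
  by rewrite mul0r mulr0.
rewrite (bigD1 (o p)) //= eqxx mul1r big1 ?addr0 // => i /negPf ->.
by rewrite mul0r mulr0.
Qed.

(** The pairs are disjoint, so each variable goes to a scalar multiple of a single variable, or to
    0, and its square goes into the ideal of the squares. *)
Lemma contract_in_squares f : in_squares f -> in_squares (contract f).
Proof.
move=> /in_squaresP[c ->]; rewrite rmorph_sum /=; apply: in_squares_sum => i.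
rewrite rmorphM rmorphXn /=; apply: in_squaresM.
rewrite /contract mmapX mmap1U.
have [p ip | /(_ _) ino] := pickP (fun p => (i == e p) || (i == o p)); last first.
  rewrite [lin _]big1 ?expr0n => [|p _]; first exact: in_squares0.
  by have /norP[/negPf ie /negPf io] := negbT (ino p); rewrite /weight ie io !mul0r subrr mul0r scale0r.
rewrite [lin _](bigD1 p) //= big1 ?addr0 => [|q qp].
  by rewrite exprZn; apply/in_squaresZ/in_squaresXX.
suff /norP[/negPf ie /negPf io] : ~~ ((i == e q) || (i == o q)).
  by rewrite /weight ie io !mul0r subrr mul0r scale0r.
apply: contra qp; case/orP: ip => /eqP ->; case/orP.
- by rewrite (inj_eq e_inj) eq_sym.
- by rewrite (negPf (eo _ _)).
- by rewrite eq_sym (negPf (eo _ _)).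
- by rewrite (inj_eq o_inj) eq_sym.
Qed.

Lemma contract_lin_self : contract (lin a) = 0.
Proof.
rewrite contract_lin [lin _]big1 // => p _.
by rewrite [a (o p) * _]mulrC subrr mul0r scale0r.
Qed.

Lemma contract_sum : contract (lin (fun=> 1)) = lin (fun=> 1).
Proof.
rewrite contract_lin; apply: eq_bigr => p _; congr (_ *: _).
by rewrite !mul1r divff // subr_eq0.
Qed.

Lemma contract_lin_ideal p q : in_squares (p - lin a * q) -> in_squares (contract p).
Proof.
move/contract_in_squares; rewrite rmorphB rmorphM /= contract_lin_self.
by rewrite mul0r subr0.
Qed.
End Contraction.

(** * Coefficients of the squarefree monomial of top degree *)

Section TopCoefficient.
Variable K : fieldType.

(** A multinomial coefficient with all exponents at most 1, computed by peeling off one linear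
    factor at a time. *)
Lemma mcoeff_sumX n (mu : 'X_{1..n}) : squarefree mu ->
  (lin (fun=> 1 : K) ^+ mdeg mu)@_mu = (mdeg mu)`!%:R.
Proof.
have [N] := ubnP (mdeg mu); elim: N mu => // N IHN mu mN hmu.
have [mu0|mu0] := posnP (mdeg mu).
  by rewrite mu0 expr0 mcoeff1; move/eqP: mu0; rewrite mdeg_eq0 => ->.
rewrite -{1}(prednK mu0) exprS mcoeff_linM.
transitivity (\sum_(i | mu i != 0%N) (mdeg mu).-1`!%:R : K).
  apply: eq_bigr => i mui; rewrite mul1r.
  have dmu : mdeg (mu - U_(i)) = (mdeg mu).-1.
    by rewrite -[in RHS](@submK _ U_(i) mu) ?lep1mP // mdegD mdeg1 addn1.
  rewrite -dmu IHN //; first by rewrite dmu -ltnS prednK.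
  by move=> j; rewrite mnmBE (leq_trans (leq_subr _ _)).
have -> : (mdeg mu)`! = (\sum_(i | mu i != 0%N) (mdeg mu).-1`!)%N.
  rewrite sum_nat_const; case: (mdeg mu) mu0 (mdegE mu) => // d _ e.
  rewrite factS; congr (_ * _)%N; rewrite e -sum1_card [RHS]big_mkcond /=.
  by apply: eq_bigr => i _; rewrite unfold_in; case: (mu i) (hmu i) => [|[]].
by rewrite natr_sum.
Qed.

Definition ones M : 'X_{1..M} := [multinom 1%N | i < M].

Lemma squarefree_ones M : squarefree (ones M).
Proof. by move=> i; rewrite mnmE. Qed.

Lemma mdeg_ones M : mdeg (ones M) = M.
Proof. by rewrite mdegE; under eq_bigr do rewrite mnmE; rewrite sum1_card card_ord. Qed.

Lemma squarefree_onesB M i : squarefree (ones M - U_(i)).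
Proof. by move=> j; rewrite mnmBE mnmE leq_subr. Qed.

Lemma mdeg_onesB M (i : 'I_M.+1) : mdeg (ones M.+1 - U_(i)) = M.
Proof.
apply/eqP; rewrite -eqSS -[X in _ == X]mdeg_ones -addn1 -(mdeg1 i) -mdegD submK //.
by rewrite lep1mP mnmE.
Qed.

Lemma top_sumX M : (lin (fun=> 1 : K) ^+ M)@_(ones M) = M`!%:R.
Proof. by have := mcoeff_sumX (@squarefree_ones M); rewrite mdeg_ones. Qed.

Lemma top_lin N (c : 'I_N.+1 -> K) :
  (lin c * lin (fun=> 1) ^+ N)@_(ones N.+1) = N`!%:R * \sum_i c i.
Proof.
rewrite mcoeff_linM mulr_sumr; apply: eq_big => [i|i _]; first by rewrite mnmE.
have := mcoeff_sumX (squarefree_onesB i); rewrite mdeg_onesB => ->.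
exact: mulrC.
Qed.

(** The bracket is the sum of c_i d_j over ordered pairs of distinct indices; the N remaining
    variables come from the power and contribute N!. *)
Lemma top_lin2 N (c d : 'I_N.+2 -> K) :
  (lin c * (lin d * lin (fun=> 1) ^+ N))@_(ones N.+2) =
  N`!%:R * ((\sum_i c i) * (\sum_i d i) - \sum_i c i * d i).
Proof.
rewrite mcoeff_linM [(\sum_i c i) * _]mulr_suml -sumrB mulr_sumr.
apply: eq_big => [i|i _]; first by rewrite mnmE.
rewrite -mulrBr mulrCA; congr (_ * _); rewrite [\sum_i d i](bigD1 i) //= [d i + _]addrC addrK.
rewrite mcoeff_linM mulr_sumr; apply: eq_big => [j|j ji].
  by rewrite mnmBE mnmE mnm1E [j == i]eq_sym; case: (i == j).
rewrite mulrC; congr (_ * _).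
have ij : i != j by move: ji; rewrite mnmBE mnmE mnm1E; case: (i == j).
have := @mcoeff_sumX _ (ones N.+2 - U_(i) - U_(j)) _.
have -> : mdeg (ones N.+2 - U_(i) - U_(j)) = N.
  apply/eqP; rewrite -eqSS -[X in _ == X](mdeg_onesB i) -addn1 -(mdeg1 j) -mdegD submK //.
  by rewrite lep1mP mnmBE mnmE mnm1E (negPf ij).
by apply=> l; rewrite mnmBE (leq_trans (leq_subr _ _)) // squarefree_onesB.
Qed.
End TopCoefficient.

(** * Failure of surjectivity *)

Section DetDerivation.
Variables (R : comNzRingType) (D : {additive R -> R}).
Hypothesis DM : forall x y, D (x * y) = D x * y + x * D y.

Lemma derivation_prod (I : finType) (F : I -> R) :
  D (\prod_i F i) = \sum_j \prod_i (if i == j then D (F i) else F i).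
Proof.
have D1 : D 1 = 0 by apply: (addrI (D 1)); rewrite addr0 -{3}(mulr1 1) DM mulr1 mul1r.
suff h (s : seq I) : uniq s ->
    D (\prod_(i <- s) F i) = \sum_(j <- s) \prod_(i <- s) (if i == j then D (F i) else F i).
  by apply: h; apply: index_enum_uniq.
elim: s => [|x s IHs] /=; first by rewrite !big_nil.
case/andP=> xs us; rewrite !big_cons DM IHs // eqxx mulr_sumr; congr (_ * _ + _).
  by rewrite !big_seq; apply: eq_bigr => i si; case: eqP xs => // <-; rewrite si.
rewrite !big_seq; apply: eq_bigr => j sj; rewrite big_cons.
by case: eqP xs => // ->; rewrite sj.
Qed.

Lemma derivation_det n (A : 'M[R]_n) :
  D (\det A) = \sum_r \det (\matrix_(i, j) if i == r then D (A i j) else A i j).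
Proof.
rewrite /determinant raddf_sum /= exchange_big; apply: eq_bigr => s _ /=.
transitivity ((-1) ^+ perm.odd_perm s * D (\prod_i A i (s i))).
  by case: (perm.odd_perm s); rewrite ?expr1 ?expr0 ?mulN1r ?mul1r ?raddfN.
rewrite derivation_prod mulr_sumr; apply: eq_bigr => r _; congr (_ * _).
by apply: eq_bigr => i _; rewrite mxE.
Qed.
End DetDerivation.

Lemma det_row0 (R : comNzRingType) n (A : 'M[R]_n) i : (forall j, A i j = 0) -> \det A = 0.
Proof. by move=> A0; rewrite (expand_det_row A i) big1 // => j _; rewrite A0 mul0r. Qed.

(** * Polynomials acting on polynomials by differentiation *)

Section Apolarity.
Variables (K : fieldType) (n : nat).
Hypothesis charK0 : [pchar K] =i pred0.
Implicit Types (p q F : {mpoly K[n]}) (c : 'I_n -> K).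

(** Macaulay's contraction action: each variable of p acts on F as the corresponding partial
    derivative. *)
Definition apolar F p : {mpoly K[n]} := \sum_(mu <- msupp p) p@_mu *: F^`M[mu].

Lemma apolarE F p i : (msize p <= i)%N ->
  apolar F p = \sum_(mu : 'X_{1..n < i}) p@_mu *: F^`M[mu].
Proof.
move=> le_pi; rewrite /apolar (big_mksub 'X_{1..n < i}) ?msupp_uniq //=; first last.
  by move=> x /msize_mdeg_lt /leq_trans; apply.
by rewrite big_rmcond //= => j /memN_msupp_eq0 ->; rewrite scale0r.
Qed.

Lemma apolar_is_linear F : linear (apolar F).
Proof.
move=> x p q; set i := maxn (msize (x *: p + q)) (maxn (msize p) (msize q)).
rewrite !(@apolarE _ _ i) ?leq_max ?leqnn ?orbT // scaler_sumr -big_split /=.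
by apply: eq_bigr => mu _; rewrite mcoeffD mcoeffZ scalerDl scalerA.
Qed.

HB.instance Definition _ F :=
  GRing.isLinear.Build K {mpoly K[n]} {mpoly K[n]} _ (apolar F) (apolar_is_linear F).

Lemma apolarX F mu : apolar F 'X_[mu] = F^`M[mu].
Proof. by rewrite /apolar msuppX big_seq1 mcoeffX eqxx scale1r. Qed.

Lemma apolarXM F i p : apolar F ('X_i * p) = apolar F^`M(i) p.
Proof.
rewrite [p]mpolyE mulr_sumr !raddf_sum /=; apply: eq_bigr => mu _.
by rewrite -scalerAr !linearZ /= -mpolyXD !apolarX mderivmDm mderivmU1m.
Qed.

Lemma apolar0 p : apolar 0 p = 0.
Proof. by rewrite /apolar big1 // => mu _; rewrite linear0 scaler0. Qed.

Definition dirderiv c F : {mpoly K[n]} := \sum_i c i *: F^`M(i).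

(** Multiplication by a linear form is adjoint to a directional derivative, so a derivative that
    kills F makes the multiples of the form act as 0. *)
Lemma apolar_linM F c p : apolar F (lin c * p) = apolar (dirderiv c F) p.
Proof.
rewrite /lin mulr_suml raddf_sum /=.
under eq_bigr do rewrite -scalerAl linearZ /= apolarXM /apolar scaler_sumr.
rewrite exchange_big; apply: eq_bigr => mu _ /=.
rewrite linear_sum scaler_sumr /=; apply: eq_bigr => i _.
by rewrite mderivmZ !scalerA mulrC.
Qed.

Lemma dirderiv_is_linear c : linear (dirderiv c).
Proof.
move=> x p q; rewrite /dirderiv scaler_sumr -big_split /=; apply: eq_bigr => i _.
by rewrite mderivD mderivZ scalerDr !scalerA mulrC.
Qed.

HB.instance Definition _ c :=
  GRing.isLinear.Build K {mpoly K[n]} {mpoly K[n]} _ (dirderiv c) (dirderiv_is_linear c).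

Lemma dirderivM c p q : dirderiv c (p * q) = dirderiv c p * q + p * dirderiv c q.
Proof.
rewrite /dirderiv mulr_suml mulr_sumr -big_split; apply: eq_bigr => i _ /=.
by rewrite mderivM scalerDr scalerAl scalerAr.
Qed.

Lemma dirderivC c x : dirderiv c x%:MP = 0.
Proof. by rewrite /dirderiv big1 // => i _; rewrite mderivC scaler0. Qed.

Lemma dirderivXU c i : dirderiv c 'X_i = (c i)%:MP.
Proof.
rewrite /dirderiv (bigD1 i) //= big1 => [|j ji]; rewrite mderivXU.
  by rewrite eqxx addr0 -mul_mpolyC mpolyC1 mulr1.
by rewrite (negPf ji) mpolyC0 scaler0.
Qed.

Lemma mderivm_coef0 F mu : (F^`M[mu])@_0%MM = F@_mu *+ (\prod_i (mu i)`!)%N.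
Proof.
rewrite mcoeff_mderivm addm0; congr (_ *+ _); apply: eq_bigr => i _.
by rewrite ffactnn.
Qed.

(** The monomial ['X_[mu]] reads off the coefficient of F at [mu] times a product of factorials,
    which is nonzero in characteristic zero. *)
Lemma homog_apolar_eq0 F d : F \is d.-homog ->
  (forall p, p \is d.-homog -> apolar F p = 0) -> F = 0.
Proof.
move=> hF h; apply/mpolyP => mu; rewrite mcoeff0.
have [dmu|dmu] := eqVneq (mdeg mu) d; last exact: (dhomog_nemf_coeff hF).
have /(congr1 (mcoeff 0%MM)) : apolar F 'X_[mu] = 0 by apply: h; rewrite dhomogX /= dmu.
rewrite apolarX mderivm_coef0 mcoeff0 => /eqP.
rewrite -mulr_natr mulf_eq0 natf_eq0 // => /orP[/eqP //|].
by rewrite eqn0Ngt prodn_gt0 // => i; apply: fact_gt0.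
Qed.

Lemma homog_prod_ord k (G : 'I_k -> {mpoly K[n]}) (d : 'I_k -> nat) :
  (forall i, G i \is (d i).-homog) -> \prod_i G i \is (\sum_i d i)%N.-homog.
Proof. by move=> hG; elim/big_rec2: _ => [|i x y _ hx]; [apply: dhomog1|apply: dhomogM]. Qed.

Lemma homog_det k (A : 'M[{mpoly K[n]}]_k) (d : 'I_k -> nat) :
  (forall i j, A i j \is (d i).-homog) -> \det A \is (\sum_i d i)%N.-homog.
Proof.
move=> hA; apply: rpred_sum => s _.
have h : \prod_i A i (s i) \is (\sum_i d i)%N.-homog by apply: homog_prod_ord.
by case: (perm.odd_perm s); rewrite ?expr1 ?expr0 ?mulN1r ?mul1r ?rpredN.
Qed.
End Apolarity.

(** * A multilinear form of Vandermonde type that obstructs surjectivity *)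

Section NotSurjective.
Variables (K : fieldType) (h m : nat) (a : 'I_(h + m) -> K).
Hypothesis charK0 : [pchar K] =i pred0.
Hypotheses (hm : (m <= h <= m.+1)%N) (m_gt0 : (0 < m)%N).
Hypotheses (a_inj : injective a) (a_neq0 : forall i, a i != 0).

Let n := (h + m)%N.
(** Either 0 or 1, chosen so that the exponents of the h constant rows below run from s to m. *)
Let s := (m.+1 - h)%N.

(* As a function of x, the determinant of F_mx is the multilinear form with
   coefficients the products of two complementary Vandermonde determinants.  It
   is invariant under x -> x + z a, and linear in z under x -> x + z 1. *)
Let F_mx : 'M[{mpoly K[n]}]_n :=
  \matrix_(r, i) if (r < h)%N then (a i ^+ (s + r))%:MP else a i ^+ (r - h) *: 'X_i.
Let F := \det F_mx.

Lemma F_homog : F \is m.-homog.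
Proof.
have -> : m = (\sum_(r < n) (h <= r))%N.
  rewrite big_split_ord /= big1 ?add0n => [|i _]; last by rewrite leqNgt ltn_ord.
  by under eq_bigr do rewrite leq_addr; rewrite sum1_card card_ord.
apply: homog_det => r i; rewrite mxE; case: ltnP => _ /=.
  by rewrite -[(_)%:MP]mulr1 mul_mpolyC; apply/rpredZ/dhomog1.
by apply: rpredZ; rewrite dhomogX /= mdeg1.
Qed.

Lemma F_neq0 : F != 0.
Proof.
(* At this point every row r has exponent s + r, because s + h = m + 1; the matrix is Vandermonde
   with column i scaled by the power s of [a i]. *)
pose x i := a i ^+ m.+1; suff : F.@[x] != 0 by apply: contraNneq => ->; rewrite meval0.
rewrite -[F.@[x]]/(meval x F) -det_map_mx.
have -> : map_mx (meval x) F_mx = Vandermonde n (\row_i a i) *m diag_mx (\row_i a i ^+ s).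
  apply/matrixP => r i; rewrite mul_mx_diag !mxE; case: ltnP => hr.
    by rewrite mevalC exprD mulrC.
  by rewrite mevalZ mevalXU -!exprD; congr (_ ^+ _); rewrite /s; lia.
rewrite det_mulmx det_Vandermonde det_diag mulf_neq0 //; last first.
  by apply/prodf_neq0 => i _; rewrite mxE expf_neq0.
apply/prodf_neq0 => i _; apply/prodf_neq0 => j ij; rewrite !mxE subr_eq0.
by rewrite (inj_eq a_inj) eq_sym neq_ltn ij.
Qed.

(** A lower row that has become constant with exponent in the range s to m repeats one of the first
    h rows. *)
Lemma det_dup (A : 'M[{mpoly K[n]}]_n) (r : 'I_n) k :
  (h <= r)%N -> (s <= k <= m)%N -> (forall i, A r i = (a i ^+ k)%:MP) ->
  (forall r' : 'I_n, (r' < h)%N -> forall i, A r' i = (a i ^+ (s + r'))%:MP) -> \det A = 0.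
Proof.
move=> hr sk Ar Ar'.
have kh : (k - s < h)%N by rewrite /s in sk *; lia.
have kn : (k - s < n)%N by apply: (leq_trans kh); rewrite leq_addr.
apply: (@determinant_alternate _ _ _ r (Ordinal kn)).
  by apply: contraTneq kh => e; rewrite -leqNgt -[(k - s)%N]/(val (Ordinal kn)) -e.
by move=> i; rewrite Ar Ar' //= subnKC //; case/andP: sk.
Qed.

Lemma dirderiv_F_mx c r i : dirderiv c (F_mx r i) =
  if (r < h)%N then 0 else (a i ^+ (r - h) * c i)%:MP.
Proof.
rewrite mxE; case: ifP => _; first exact: dirderivC.
by rewrite linearZ /= dirderivXU -mul_mpolyC mpolyCM.
Qed.

(** Differentiating a row r >= h makes it constant with exponent r - h + 1, between 1 and m, and s
    is at most 1. *)
Lemma dirderiv_F : dirderiv a F = 0.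
Proof.
rewrite (derivation_det (dirderivM a)) big1 // => r _.
case: (ltnP r h) => hr.
  by apply: (@det_row0 _ _ _ r) => j; rewrite mxE eqxx /= dirderiv_F_mx hr.
apply: (det_dup (k := (r - h).+1) hr); first by have := ltn_ord r; rewrite /n /s; lia.
  by move=> i; rewrite mxE eqxx /= dirderiv_F_mx ltnNge hr /= exprSr.
by move=> r' hr' i; rewrite mxE; case: eqP => [e|_]; [by rewrite e ltnNge hr in hr'|rewrite mxE hr'].
Qed.

(** Differentiating a row r > h gives the exponent r - h, a repeated row. The first derivative thus
    comes from row h alone; a second derivative kills that row, now constant, or again repeats
    one. *)
Lemma dirderiv2_F : dirderiv (fun=> 1) (dirderiv (fun=> 1) F) = 0.
Proof.
have hn : (h < n)%N by rewrite /n -[X in (X < _)%N]addn0 ltn_add2l.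
pose r0 := Ordinal hn.
rewrite (derivation_det (dirderivM _)) (bigD1 r0) //= big1 => [|r r_r0]; last first.
  case: (ltnP r h) => hr.
    by apply: (@det_row0 _ _ _ r) => j; rewrite mxE eqxx /= dirderiv_F_mx hr.
  have hr' : (h < r)%N by rewrite ltn_neqAle hr andbT eq_sym -[h]/(val r0) (inj_eq val_inj).
  apply: (det_dup (k := (r - h)) hr); first by move: hr' (ltn_ord r); rewrite /s /n; lia.
    by move=> i; rewrite mxE eqxx /= dirderiv_F_mx ltnNge hr /= mulr1.
  by move=> r' hr'' i; rewrite mxE; case: eqP => [e|_]; [by rewrite e ltnNge hr in hr''|rewrite mxE hr''].
rewrite addr0 (derivation_det (dirderivM _)) big1 // => r _.
case: (ltnP r h) => hr.
  apply: (@det_row0 _ _ _ r) => j; rewrite !mxE eqxx; case: eqP => [e|_].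
    by rewrite e /= ltnn in hr.
  by rewrite hr /= dirderivC.
have [e|r_r0] := eqVneq r r0.
  apply: (@det_row0 _ _ _ r) => j; rewrite !mxE e !eqxx /= ltnn subnn expr0 scale1r.
  by rewrite /= dirderivXU dirderivC.
have hr' : (h < r)%N by rewrite ltn_neqAle hr andbT eq_sym -[h]/(val r0) (inj_eq val_inj).
apply: (det_dup (k := (r - h)) hr); first by move: hr' (ltn_ord r); rewrite /s /n; lia.
  by move=> i; rewrite mxE eqxx mxE (negPf r_r0) /= dirderiv_F_mx ltnNge hr /= mulr1.
move=> r' hr'' i; rewrite mxE; case: eqP => [e|_]; first by rewrite e ltnNge hr in hr''.
rewrite mxE; case: eqP => [e|_]; first by rewrite e /= ltnn in hr''.
by rewrite mxE hr''.
Qed.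

(** The variable i occurs in column i only, with degree at most 1; the transpose allows
    differentiating row by row. *)
Lemma mderiv2_F i : F^`M(i)^`M(i) = 0.
Proof.
rewrite /F -det_tr (derivation_det (mderivM i)) (bigD1 i) //= big1 => [|j ji]; last first.
  apply: (@det_row0 _ _ _ j) => r; rewrite !mxE eqxx; case: ifP => _; first exact: mderivC.
  by rewrite /= mderivZ mderivXU eq_sym (negPf ji) mpolyC0 scaler0.
rewrite addr0 (derivation_det (mderivM i)) big1 // => j _.
apply: (@det_row0 _ _ _ j) => r; rewrite !mxE eqxx; have [ji|ji] := eqVneq j i.
  case: ifP => _; first by rewrite /= mderivC mderiv0.
  by rewrite /= mderivZ mderivXU mderivZ mderivC scaler0.
case: ifP => _; first exact: mderivC.
by rewrite /= mderivZ mderivXU eq_sym (negPf ji) mpolyC0 scaler0.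
Qed.

(** Otherwise every form of degree m would lie in the ideal of [lin a], the square of the sum of the
    variables and the squares. All of these kill F by differentiation, which would force F = 0. *)
Lemma not_surjective : exists2 z, z \is m.-homog &
  forall p q, ~ in_squares (z - lin a * p - lin (fun=> 1) ^+ 2 * q).
Proof.
apply: boolp.contrapT => /boolp.forall2NP noz.
have := F_neq0; rewrite (homog_apolar_eq0 charK0 F_homog) ?eqxx // => z hz.
case: (noz z) => // /boolp.existsNP[p /boolp.existsNP[q /boolp.contrapT /in_squaresP[c ec]]].
have -> : z = lin a * p + lin (fun=> 1) * (lin (fun=> 1) * q) + \sum_i 'X_i * ('X_i * c i).
  under eq_bigr do rewrite mulrA -expr2 mulrC.
  by rewrite -ec mulrA -expr2; ring.
rewrite !linearD /= !apolar_linM dirderiv_F dirderiv2_F !apolar0 !add0r raddf_sum big1 // => i _ /=.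
by rewrite !apolarXM mderiv2_F apolar0.
Qed.
End NotSurjective.

(** * Genericity along a line *)

Section MatrixPencil.
Variable K : fieldType.

Lemma subspace_mx N (S : 'rV[K]_N -> Prop) : S 0 ->
  (forall x u v, S u -> S v -> S (x *: u + v)) ->
  exists C : 'M[K]_N, forall v, S v <-> (v <= C)%MS.
Proof.
move=> S0 SD.
have SZ x u : S u -> S (x *: u) by move=> Su; rewrite -[_ *: _]addr0; apply: SD.
(* C is taken of maximal rank among the matrices with row space inside S; adjoining a vector of S
   cannot increase the rank. *)
pose Q r := boolp.asbool (exists C : 'M[K]_N,
  (forall v : 'rV_N, (v <= C)%MS -> S v) /\ \rank C = r).
have exQ : exists r, Q r.
  exists 0%N; apply/boolp.asboolP; exists 0; rewrite mxrank0; split=> // v.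
  by rewrite submx0 => /eqP ->.
have Qle r : Q r -> (r <= N)%N by case/boolp.asboolP => C [_ <-]; apply: rank_leq_row.
case: (ex_maxnP exQ Qle) => r /boolp.asboolP[C [CS rC]] maxr.
exists C => v; split=> [Sv|]; last exact: CS.
have : Q (\rank (C + v)%MS).
  apply/boolp.asboolP; exists (C + v)%MS; split=> // u /sub_addsmxP[[x y] /= ->].
  rewrite addrC [y]mx11_scalar mul_scalar_mx; apply: SD => //.
  by apply: CS; apply: submxMl.
move/maxr; rewrite -rC => le_rank.
have /mxrank_leqif_sup := addsmxSl C v => -[_ e].
have : (C + v <= C)%MS by rewrite -e eqn_leq le_rank andbT mxrankS // addsmxSl.
by apply: submx_trans; apply: addsmxSr.
Qed.

(** U and V reduce A0 to an identity matrix of size its rank. The determinant of the reduced pencil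
    is a polynomial in s with value 1 at 0. *)
Lemma rank_pencil p q (A0 A1 : 'M[K]_(p, q)) :
  exists2 P : {poly K}, P != 0 & forall s, P.[s] != 0 -> (\rank A0 <= \rank (A0 + s *: A1)%R)%N.
Proof.
have /row_fullP[U UA] := col_base_full A0; have /row_freeP[V AV] := row_base_free A0.
have UAV : U *m A0 *m V = 1%:M.
  transitivity (U *m (col_base A0 *m row_base A0) *m V); first by rewrite mulmx_base.
  by rewrite mulmxA UA mul1mx AV.
pose B : 'M[{poly K}]_(\rank A0) := map_mx polyC 1%:M + 'X *: map_mx polyC (U *m A1 *m V).
have evB s : (\det B).[s] = \det (U *m (A0 + s *: A1) *m V).
  rewrite -horner_evalE -det_map_mx; congr (\det _).
  rewrite mulmxDr mulmxDl UAV -scalemxAr -scalemxAl; apply/matrixP => i j.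
  by rewrite !mxE /= /horner_eval !hornerE.
exists (\det B) => [|s].
  apply: contraTneq (oner_neq0 K) => /(congr1 (fun P => P.[0])).
  by rewrite evB scale0r addr0 UAV det1 horner0 => ->; rewrite eqxx.
rewrite evB => dB; have uB : U *m (A0 + s *: A1) *m V \in unitmx by rewrite unitmxE unitfE.
rewrite -{1}(mxrank_unit uB).
apply: (@leq_trans (\rank (U *m (A0 + s *: A1)%R))); first exact: mxrankM_maxl.
exact: mxrankM_maxr.
Qed.

(** The kernel modulo C' contains C for every s and equals C at s = 0. Where the rank does not drop,
    the kernel cannot be larger than C. *)
Lemma pencil_inj p q (A0 A1 : 'M[K]_(p, q)) (C : 'M_p) (C' : 'M_q) :
  (C *m A0 <= C')%MS -> (C *m A1 <= C')%MS ->
  (forall v : 'rV_p, (v *m A0 <= C')%MS -> (v <= C)%MS) ->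
  exists2 P : {poly K}, P != 0 & forall s, P.[s] != 0 ->
    forall v : 'rV_p, (v *m (A0 + s *: A1) <= C')%MS -> (v <= C)%MS.
Proof.
move=> CA0 CA1 inj0; set R := cokermx C'.
have [P P0 hP] := rank_pencil (A0 *m R) (A1 *m R).
exists P => // s /hP; rewrite scalemxAl -mulmxDl; set As := A0 + _ => rk v vC'.
have CK : (C <= kermx (As *m R))%MS.
  rewrite sub_kermx mulmxA -submxE /As mulmxDr -scalemxAr addmx_sub //.
  exact: scalemx_sub.
have /mxrank_leqif_sup[_ e] := CK; suff : (kermx (As *m R) <= C)%MS.
  by apply: submx_trans; rewrite sub_kermx mulmxA -submxE.
rewrite -e eqn_leq mxrankS //= mxrank_ker.
apply: leq_trans (leq_sub2l p rk) _; rewrite -mxrank_ker; apply: mxrankS.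
apply/rV_subP => u; rewrite sub_kermx mulmxA -submxE; exact: inj0.
Qed.

(** Surjectivity modulo C' means that the image has the full rank of the cokernel matrix R, and this
    rank does not drop for general s. *)
Lemma pencil_surj p q (A0 A1 : 'M[K]_(p, q)) (C' : 'M_q) :
  (forall w : 'rV_q, exists v : 'rV_p, (w - v *m A0 <= C')%MS) ->
  exists2 P : {poly K}, P != 0 & forall s, P.[s] != 0 ->
    forall w : 'rV_q, exists v : 'rV_p, (w - v *m (A0 + s *: A1) <= C')%MS.
Proof.
move=> surj0; set R := cokermx C'.
have [P P0 hP] := rank_pencil (A0 *m R) (A1 *m R).
exists P => // s /hP; rewrite scalemxAl -mulmxDl; set As := A0 + _ => rk w.
have RA0 : (R <= A0 *m R)%MS.
  apply/row_subP => i; have [v] := surj0 (delta_mx 0 i).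
  rewrite submxE mulmxBl subr_eq0 -rowE => /eqP ->.
  by rewrite -mulmxA submxMl.
have /mxrank_leqif_sup[_ e] : (As *m R <= R)%MS by apply: submxMl.
have : (R <= As *m R)%MS.
  by rewrite -e eqn_leq mxrankM_maxr (leq_trans _ rk) // mxrankS.
case/submxP => D eR; exists (w *m D).
by rewrite submxE mulmxBl -/R -2!mulmxA -eR subrr.
Qed.

Lemma poly_nonroot (P : {poly K}) : [pchar K] =i pred0 -> P != 0 -> exists s, P.[s] != 0.
Proof.
move=> charK0 P0; apply: boolp.contrapT => /boolp.forallNP h.
pose rs : seq K := [seq i%:R | i <- iota 0 (size P)].
have rootP : all (root P) rs.
  by apply/allP => x _; apply/rootP/eqP; apply: contraT => /h.
have uniq_rs : uniq rs.
  rewrite map_inj_uniq ?iota_uniq // => i j.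
  wlog ij : i j / (i <= j)%N.
    by move=> hw; case/orP: (leq_total i j) => [/hw //|/hw ji e]; apply/esym/ji.
  move/eqP; rewrite eq_sym -subr_eq0 -natrB // natf_eq0 // subn_eq0 => ji.
  by apply/eqP; rewrite eqn_leq ij.
by have := max_poly_roots P0 rootP uniq_rs; rewrite size_map size_iota ltnn.
Qed.
End MatrixPencil.

Section MultiplicationModulo.
Variables (K : fieldType) (n : nat) (J : {mpoly K[n]} -> Prop).
Implicit Types (a : 'I_n -> K) (p z : {mpoly K[n]}).

Definition inj_mod a d := forall p, p \is d.-homog -> J (lin a * p) -> J p.
Definition surj_mod a d := forall z, z \is d.+1.-homog ->
  exists2 p, p \is d.-homog & J (z - lin a * p).
End MultiplicationModulo.

Section Genericity.
Import VectorInternalTheory.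
Variables (K : fieldType) (n' : nat).
Let n := n'.+1.
Implicit Types (a b : 'I_n -> K) (p q : {mpoly K[n]}).
Variable J : {mpoly K[n]} -> Prop.
Hypotheses (J0 : J 0) (JD : forall p q, J p -> J q -> J (p + q)).
Hypothesis JM : forall p q, J q -> J (p * q).

Let JZ x p : J p -> J (x *: p).
Proof. by rewrite -mul_mpolyC; apply: JM. Qed.

(** Forms of degree d are put in coordinates, so that multiplication by a linear form and the degree
    d part of J become matrices. *)
Let N d := dim (dhomog n K d).
Let rho d (v : 'rV[K]_(N d)) : {mpoly K[n]} := mpoly_of_dhomog (@r2v K (dhomog n K d) v).

Let rhoD d x u v : @rho d (x *: u + v) = x *: rho u + rho v.
Proof. by rewrite /rho !linearP. Qed.

Let rho_homog d (v : 'rV_(N d)) : rho v \is d.-homog.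
Proof. exact: dhomog_is_dhomog. Qed.

Let rho_onto d p : p \is d.-homog -> exists v : 'rV_(N d), p = rho v.
Proof. by move=> hp; exists (v2r (DHomog hp)); rewrite /rho v2rK. Qed.

Let lin_mx a d : exists A : 'M[K]_(N d, N d.+1), forall v, rho (v *m A) = lin a * rho v.
Proof.
have /boolp.choice[f hf] (i : 'I_(N d)) :
    exists w : 'rV_(N d.+1), lin a * rho (delta_mx 0 i) = rho w.
  by apply/rho_onto/lin_homogM/rho_homog.
exists (\matrix_i f i) => v.
have rho0 e : @rho e 0 = 0 by rewrite /rho !linear0.
have rhoZ e x u : @rho e (x *: u) = x *: rho u by rewrite -[x *: u]addr0 rhoD rho0 addr0.
have rho_sum e k (F : 'I_k -> 'rV_(N e)) : rho (\sum_i F i) = \sum_i rho (F i).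
  by elim/big_rec2: _ => [|i x y _ <-]; rewrite ?rho0 // -[F i]scale1r rhoD !scale1r.
rewrite mulmx_sum_row {2}(row_sum_delta v) !rho_sum mulr_sumr; apply: eq_bigr => i _.
by rewrite !rhoZ rowK -hf scalerAr.
Qed.

Let J_mx d : exists C : 'M[K]_(N d), forall v, J (rho v) <-> (v <= C)%MS.
Proof.
apply: (@subspace_mx K (N d) (fun v => J (rho v))).
  by rewrite /rho !linear0.
by move=> x u v Ju Jv; rewrite rhoD; apply/JD/Jv/JZ.
Qed.

Let lin_pencil a b s p : lin (fun i => a i + s * b i) * p = lin a * p + s *: (lin b * p).
Proof. by rewrite -linD -linZ mulrDl scalerAl. Qed.

Lemma generic_inj_mod a b d : inj_mod J a d -> exists2 P : {poly K}, P != 0 &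
  forall s, P.[s] != 0 -> inj_mod J (fun i => a i + s * b i) d.
Proof.
move=> inja; have [A0 hA0] := lin_mx a d; have [A1 hA1] := lin_mx b d.
have [C hC] := J_mx d; have [C' hC'] := J_mx d.+1.
have CA A c : (forall v, rho (v *m A) = lin c * rho v) -> (C *m A <= C')%MS.
  move=> hA; apply/row_subP => i; rewrite row_mul -hC' hA; apply: JM.
  by rewrite hC row_sub.
have [|P P0 hP] := pencil_inj (CA _ _ hA0) (CA _ _ hA1).
  by move=> v; rewrite -hC' -hC hA0; apply/inja/rho_homog.
exists P => // s /hP {}hP p hp; have [v ->] := rho_onto hp.
rewrite lin_pencil -hA0 -hA1 hC addrC -rhoD scalemxAr -mulmxDr addrC hC'.
exact: hP.
Qed.

Lemma generic_surj_mod a b d : surj_mod J a d -> exists2 P : {poly K}, P != 0 &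
  forall s, P.[s] != 0 -> surj_mod J (fun i => a i + s * b i) d.
Proof.
move=> surja; have [A0 hA0] := lin_mx a d; have [A1 hA1] := lin_mx b d.
have [C' hC'] := J_mx d.+1.
have rhoB e u v : @rho e (u - v) = rho u - rho v by rewrite addrC -scaleN1r rhoD scaleN1r addrC.
have [w|P P0 hP] := @pencil_surj K _ _ A0 A1 C'.
  have [_ /rho_onto[v ->]] := surja _ (rho_homog w).
  by rewrite -hA0 -rhoB hC' => h; exists v.
exists P => // s /hP {}hP z hz; have [w ->] := rho_onto hz.
have [v hv] := hP w; exists (rho v); first exact: rho_homog.
by rewrite lin_pencil -hA0 -hA1 addrC [_ + s *: _]addrC -rhoD scalemxAr -mulmxDr
  [_ *: _ + _]addrC addrC -rhoB hC'.
Qed.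
End Genericity.

(** * Injectivity and its failure *)

Section LefschetzIdeal.
Variables (K : fieldType) (n : nat).
Implicit Types (p q f g : {mpoly K[n]}) (a t : 'I_n -> K).

Local Notation ell := (lin (fun=> 1 : K)).

Definition in_ideal k p := exists q, in_squares (p - ell ^+ k * q).

Lemma in_squares_ideal k p : in_squares p -> in_ideal k p.
Proof. by exists 0; rewrite mulr0 subr0. Qed.

Lemma in_ideal0 k : in_ideal k 0.
Proof. exact/in_squares_ideal/in_squares0. Qed.

Lemma in_idealD k p q : in_ideal k p -> in_ideal k q -> in_ideal k (p + q).
Proof.
move=> [p' hp] [q' hq]; exists (p' + q').
by rewrite mulrDr opprD addrACA; apply: in_squaresD.
Qed.

Lemma in_idealM k p q : in_ideal k q -> in_ideal k (p * q).
Proof. by move=> [q' hq]; exists (p * q'); rewrite mulrCA -mulrBr; apply: in_squaresM. Qed.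

Lemma mcoeff_pihomog d p mu : (pihomog mdeg d p)@_mu = if mdeg mu == d then p@_mu else 0.
Proof.
rewrite pihomogE [p in RHS]mpolyE !raddf_sum /= big_mkcond /=.
case: ifP => dmu; last first.
  rewrite big1 // => nu _; case: ifP => // dnu.
  by rewrite mcoeffZ mcoeffX; case: (nu =P mu) dnu => [->|]; rewrite ?dmu // mulr0.
apply: eq_bigr => nu _; case: ifP => // dnu.
by rewrite mcoeffZ mcoeffX; case: (nu =P mu) dnu => [->|]; rewrite ?dmu // mulr0.
Qed.

(** Only the component of q of degree d - k matters. The clause for d < k is needed because the
    truncated difference would otherwise allow a constant. *)
Lemma in_ideal_homog k d p : p \is d.-homog -> in_ideal k p ->
  exists q, [/\ q \is (d - k).-homog, (d < k)%N -> q = 0 & in_squares (p - ell ^+ k * q)].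
Proof.
move=> hp [q sq]; pose q' := \sum_(j < msize q | (k + j == d)%N) pihomog mdeg j q.
exists q'; split.
- apply: rpred_sum => j /eqP <-; rewrite addKn; exact: pihomogP.
- by move=> dk; rewrite /q' big_pred0 // => j; apply/eqP; lia.
suff -> : ell ^+ k * q' = pihomog mdeg d (ell ^+ k * q).
  rewrite -[p](pihomog_dE hp) -pihomogB => mu hmu.
  by rewrite mcoeff_pihomog sq // if_same.
rewrite (pihomog_partitionE (leqnn (msize q))) /q' !mulr_sumr raddf_sum big_mkcond /=.
apply: eq_bigr => j _; have h := lin_homogX (fun=> 1 : K) k (pihomogP mdeg j q).
by case: eqP h => [->|/eqP kj] h; [rewrite (pihomog_dE h) | rewrite (pihomog_ne0 kj h)].
Qed.

Lemma homog0_const p : p \is 0.-homog -> p = (p@_0%MM)%:MP.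
Proof.
move=> hp; apply/mpolyP => mu; rewrite mcoeffC.
have [->|mu0] := eqVneq mu 0%MM; first by rewrite mulr1.
by rewrite mulr0 (dhomog_nemf_coeff hp) //= mdeg_eq0.
Qed.
End LefschetzIdeal.

(** * Necessary conditions for multiples of a linear form, read off from matchings *)

Section Matchings.
Variables (K : fieldType) (n' : nat).
Hypothesis charK0 : [pchar K] =i pred0.
Let n := n'.+1.
Variable a : 'I_n -> K.
Hypothesis a_inj : injective a.
Implicit Types (p q f g : {mpoly K[n]}) (c d : 'I_n -> K) (s : 'S_n).

Local Notation ell := (lin (fun=> 1 : K)).

(* The permutation s encodes the matching of s(2p) with s(2p+1). *)
Definition mate1 M s (p : 'I_M) : 'I_n := s (inord (2 * p)).
Definition mate2 M s (p : 'I_M) : 'I_n := s (inord (2 * p).+1).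

(** The coefficient, in the contraction of [lin c], of the variable that stands for the pair i,
    j. *)
Definition mate_coef c (i j : 'I_n) : K := (c i * a j - c j * a i) / (a j - a i).

Lemma mate_coef_const x i j : i != j -> mate_coef (fun=> x) i j = x.
Proof.
move=> ij; rewrite /mate_coef -mulrBr mulfK // subr_eq0.
by rewrite (inj_eq a_inj) eq_sym.
Qed.

Section FixedMatching.
Variables (M : nat) (s : 'S_n).
Hypothesis Mn : (2 * M <= n)%N.

Lemma mate_neq (p q : 'I_M) : mate1 s p != mate2 s q.
Proof.
rewrite (inj_eq perm_inj); apply/eqP => /(congr1 val) /=.
by have hp := ltn_ord p; have hq := ltn_ord q; rewrite !inordK -/n; lia.
Qed.

Definition match_contract : {mpoly K[n]} -> {mpoly K[M]} :=
  contract a (mate1 s) (mate2 s).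

HB.instance Definition _ := GRing.RMorphism.copy match_contract
  (contract a (@mate1 M s) (@mate2 M s)).

Let mate1_inj : injective (@mate1 M s).
Proof.
move=> /= p q /perm_inj /(congr1 val) /=; have hp := ltn_ord p; have hq := ltn_ord q.
by rewrite !inordK -/n; [move=> ?; apply: val_inj; rewrite /=; lia|lia|lia].
Qed.

Let mate2_inj : injective (@mate2 M s).
Proof.
move=> p q /perm_inj /(congr1 val) /=; have hp := ltn_ord p; have hq := ltn_ord q.
by rewrite !inordK -/n; [move=> ?; apply: val_inj; rewrite /=; lia|lia|lia].
Qed.

Let a_mate (p : 'I_M) : a (@mate2 M s p) != a (mate1 s p).
Proof. by rewrite (inj_eq a_inj) eq_sym mate_neq. Qed.

Lemma match_contract_lin c : match_contract (lin c) =
  lin (fun p : 'I_M => mate_coef c (mate1 s p) (mate2 s p)).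
Proof. exact: contract_lin. Qed.

Lemma match_contract_sum : match_contract ell = ell.
Proof. exact: contract_sum. Qed.

Lemma match_lin_ideal p q : in_squares (p - lin a * q) -> (match_contract p)@_(ones M) = 0.
Proof.
move/(contract_lin_ideal mate1_inj mate2_inj mate_neq); apply.
exact: squarefree_ones.
Qed.
End FixedMatching.

Lemma match_const M x q : (2 * M <= n)%N ->
  in_squares (ell ^+ M * x%:MP - lin a * q) -> x = 0.
Proof.
move=> Mn /(match_lin_ideal 1%g Mn).
rewrite rmorphM rmorphXn /= match_contract_sum //.
rewrite mulrC [match_contract _ _ _]mmapC mcoeffCM top_sumX => /eqP.
by rewrite mulf_eq0 natf_eq0 // eqn0Ngt fact_gt0 orbF => /eqP.
Qed.

Lemma match_sum N c q s : (2 * N.+1 <= n)%N ->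
  in_squares (ell ^+ N * lin c - lin a * q) ->
  \sum_(p < N.+1) mate_coef c (mate1 s p) (mate2 s p) = 0.
Proof.
move=> Mn /(match_lin_ideal s Mn).
rewrite rmorphM rmorphXn /= match_contract_sum //.
rewrite match_contract_lin mulrC top_lin => /eqP.
by rewrite mulf_eq0 natf_eq0 // eqn0Ngt fact_gt0 => /eqP.
Qed.

Lemma perm_prefix3 (i j l x y z : 'I_n) : i != j -> i != l -> j != l ->
  x != y -> x != z -> y != z -> exists s : 'S_n, [/\ s x = i, s y = j & s z = l].
Proof.
move=> ij il jl xy xz yz.
pose s1 := tperm x i; pose s2 := (s1 * tperm (s1 y) j)%g; pose s3 := (s2 * tperm (s2 z) l)%g.
have s1x : s1 x = i by rewrite /s1 tpermL.
have s2x : s2 x = i.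
  by rewrite permM s1x tpermD //; [rewrite -s1x (inj_eq perm_inj) eq_sym|rewrite eq_sym].
have s2y : s2 y = j by rewrite permM tpermL.
exists s3; split; rewrite permM ?tpermL //.
  by rewrite s2x tpermD //; [rewrite -s2x (inj_eq perm_inj) eq_sym|rewrite eq_sym].
by rewrite s2y tpermD //; [rewrite -s2y (inj_eq perm_inj) eq_sym|rewrite eq_sym].
Qed.

(* Exchanging the partner of one vertex with an unmatched vertex. *)
Lemma match_exchange M (H : 'I_n -> 'I_n -> K) x : (2 * M.+1 < n)%N ->
  (forall s, \sum_(p < M.+1) H (mate1 s p) (mate2 s p) = x) ->
  forall i j l, i != j -> i != l -> j != l -> H i j = H i l.
Proof.
move=> Mn hH i j l ij il jl.
have ordE (u v : nat) : (u < n)%N -> (v < n)%N -> (inord u == inord v :> 'I_n) = (u == v).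
  by move=> hu hv; rewrite -val_eqE /= !inordK.
(* The matching of s pairs i with j and leaves l, at the last index, unmatched; composing with a
   transposition replaces j by l. *)
have [|||s [s0 s1 s2]] := @perm_prefix3 i j l (inord 0) (inord 1) (inord n') ij il jl.
- by rewrite ordE //; lia.
- by rewrite ordE //; rewrite /n in Mn *; lia.
- by rewrite ordE //; rewrite /n in Mn *; lia.
have := hH s; rewrite -(hH (tperm (inord 1) (inord n') * s)%g) !big_ord_recl.
rewrite /mate1 /mate2 !permM /= tpermL tpermD ?ordE //; try by rewrite /n in Mn *; lia.
rewrite s0 s1 s2 => e; apply: (addIr _ (etrans e _)); congr (_ + _).
apply: eq_bigr => p _; rewrite !permM !tpermD ?ordE //; have := ltn_ord p;
  by rewrite /bump /n in Mn *; lia.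
Qed.
End Matchings.

Section Injectivity.
Variables (K : fieldType) (n' : nat).
Hypothesis charK0 : [pchar K] =i pred0.
Let n := n'.+1.
Variable a : 'I_n -> K.
Hypotheses (a_inj : injective a) (a_neq0 : forall i, a i != 0).
Implicit Types (p q f g u : {mpoly K[n]}) (c : 'I_n -> K) (d k : nat) (s : 'S_n).

Local Notation ell := (lin (fun _ : 'I_n => 1 : K)).
Let t i := (a i)^-1.
Let ta i : t i * a i = 1. Proof. by rewrite mulVf. Qed.
Let one1 (i : 'I_n) : (1 : K) * 1 = 1. Proof. exact: mulr1. Qed.

Let a_sub i j : i != j -> a j - a i != 0.
Proof. by move=> ij; rewrite subr_eq0 (inj_eq a_inj) eq_sym. Qed.

Lemma surj_mod_high k d : (n <= 2 * d + 1)%N -> surj_mod (@in_ideal K n k) a d.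
Proof.
move=> nd z hz; have [|u hu sq] := lin_surj charK0 ta (v := z) (d := d) (k := 1) _ nd.
  by rewrite addn1.
by exists u => //; apply: in_squares_ideal; rewrite -[lin a]expr1.
Qed.

Lemma mate_coef_sym c i j : mate_coef a c i j = mate_coef a c j i.
Proof. by rewrite /mate_coef -[RHS]mulrNN -invrN !opprB. Qed.

(** If [lin a * p] is [ell ^+ k * q] modulo squares, then q has degree d + 1 - k, which in the three
    cases is negative, 0 or 1. Matchings show that q is zero or a multiple of [lin a], and then
    [lin a] cancels by [lin_inj]. *)
Lemma inj_mod_low k d : (2 * d + 1 <= n)%N ->
  [|| (d.+1 < k)%N, (d.+1 == k) && (2 * k <= n)%N | (d == k) && (n == 2 * k + 3)%N] ->
  inj_mod (@in_ideal K n k) a d.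
Proof.
move=> dn cases p hp hJ.
have [q [hq q0 sq]] := in_ideal_homog (lin_homogM a hp) hJ.
have inj_sq f : f \is d.-homog -> in_squares (lin a * f) -> in_squares f.
  by move=> hf hs; apply: (lin_inj charK0 ta hf dn); rewrite expr1.
case/or3P: cases => [dk|/andP[/eqP dk kn]|/andP[/eqP dk /eqP nk]].
- by apply/in_squares_ideal/inj_sq => //; move: sq; rewrite q0 // mulr0 subr0.
- apply/in_squares_ideal/inj_sq => //.
  move: sq; rewrite -opprB => /in_squaresN; rewrite opprK => sq.
  have eq0 := homog0_const (p := q); rewrite eq0 in sq; last by move: hq; rewrite dk subnn.
  have x0 := match_const charK0 a_inj kn sq.
  by move/in_squaresN: sq; rewrite x0 mpolyC0 mulr0 sub0r opprK.
(* All the coefficients of the contractions of q agree and sum to 0, so they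
   vanish, which means that q is proportional to lin a. *)
subst d; have [c ec] : exists c, q = lin c by apply: homog1_lin; rewrite -(subSnn k).
have sq' s : \sum_(i < k.+1) mate_coef a c (mate1 s i) (mate2 s i) = 0.
  apply: (match_sum charK0 a_inj (q := p)); first by rewrite -/n nk; lia.
  by rewrite -opprB -ec; apply: in_squaresN.
have ex i j l : i != j -> i != l -> mate_coef a c i j = mate_coef a c i l.
  have [->//|jl] := eqVneq j l => ij il.
  by apply: (match_exchange _ sq') => //; rewrite -/n nk; lia.
have all_eq i j x y : i != j -> x != y -> mate_coef a c i j = mate_coef a c x y.
  move=> ij xy; have [E|ix] := eqVneq i x; first by rewrite E in ij *; apply: ex.
  rewrite (ex i j x) // mate_coef_sym; apply: ex => //; by rewrite eq_sym.
have all0 i j : i != j -> c i * a j = c j * a i.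
  move=> ij; apply/eqP; rewrite -subr_eq0.
  suff : mate_coef a c i j == 0.
    by rewrite /mate_coef mulf_eq0 invr_eq0 (negPf (a_sub ij)) orbF.
  have := sq' 1%g; rewrite (eq_bigr (fun=> mate_coef a c i j)) => [|p' _].
    by rewrite sumr_const card_ord -mulr_natr => /eqP; rewrite mulf_eq0 natf_eq0 ?orbF.
  by apply: all_eq => //; apply: (mate_neq 1%g (M := k.+1)); rewrite -/n nk; lia.
have {}ec : q = (c ord0 / a ord0) *: lin a.
  rewrite ec linZ; apply: eq_bigr => i _; congr (_ *: _).
  have [->|i0] := eqVneq i ord0; first by rewrite divfK.
  by rewrite mulrAC -(all0 _ _ i0) mulfK.
exists (c ord0 / a ord0)%:MP; apply: inj_sq.
  apply: rpredB => //; rewrite -[X in _ \is X.-homog]addn0; apply: lin_homogX.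
  by rewrite -[_%:MP]mulr1 mul_mpolyC; apply/rpredZ/dhomog1.
by move: sq; rewrite ec -mul_mpolyC mulrBr; congr in_squares; ring.
Qed.

(** Injectivity puts f in the ideal, say f = [ell ^+ k * f'] modulo squares; the common factor
    [ell ^+ k] then cancels, being injective in degree d + 1 - k. *)
Lemma inj_mod_cancel k d f g : (k <= d)%N -> (2 * (d.+1 - k) + k <= n)%N ->
  inj_mod (@in_ideal K n k) a d -> f \is d.-homog -> g \is (d.+1 - k).-homog ->
  in_squares (ell ^+ k * g - lin a * f) -> exists f', in_squares (g - lin a * f').
Proof.
move=> kd dn inja hf hg sq.
have Jf : in_ideal k (lin a * f) by exists g; rewrite -opprB; apply: in_squaresN.
have [f' [hf' _ sq']] := in_ideal_homog hf (inja f hf Jf).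
exists f'; apply: (lin_inj charK0 one1 _ dn).
  by rewrite rpredB // subSn //; apply: lin_homogM.
have := in_squaresD sq (in_squaresM (lin a) sq').
by congr in_squares; ring.
Qed.

Lemma mderiv_exp p m i : (p ^+ m.+1)^`M(i) = m.+1%:R *: (p ^+ m * p^`M(i)).
Proof.
elim: m => [|m IHm]; first by rewrite expr1 expr0 mul1r scale1r.
by rewrite exprS mderivM IHm [p ^+ m.+1]exprS !scaler_nat; ring.
Qed.

Lemma lin_mulE c p : lin c * p = \sum_i (c i)%:MP * ('X_i * p).
Proof. by rewrite mulr_suml; apply: eq_bigr => i _; rewrite -scalerAl mul_mpolyC. Qed.

Lemma lower_sumX_lin m c : lower t (ell ^+ m.+2 * lin c) = ell ^+ m *
  (((m.+2%:R * \sum_i t i) *: (ell * lin c) + (\sum_i t i * c i) *: (ell * ell))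
   - ((m.+2 * m.+1)%:R *: (lin t * lin c) + (2 * m.+2)%:R *: (ell * lin (fun i => t i * c i)))).
Proof.
(* The first derivative in the variable i is A1 + c_i A2, and the second is A3 + c_i A4. *)
pose A1 := m.+2%:R * ell ^+ m.+1 * lin c; pose A2 := ell ^+ m.+2.
pose A3 := (m.+2 * m.+1)%:R * ell ^+ m * lin c; pose A4 := (2 * m.+2)%:R * ell ^+ m.+1.
transitivity ((\sum_i t i)%:MP * A1 + (\sum_i t i * c i)%:MP * A2
  - (lin t * A3 + lin (fun i => t i * c i) * A4)).
  rewrite !lin_mulE !rmorph_sum !mulr_suml -!big_split -sumrB; apply: eq_bigr => i _ /=.
  rewrite /sqderiv !(mderivM, mderivD, mderivZ, mderiv_exp, mderiv_lin, mderivC).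
  rewrite -!mul_mpolyC !mpolyCM !mpolyC1 !mpolyC_nat.
  by rewrite /A1 /A2 /A3 /A4 /=; rewrite !natrM; ring.
rewrite -!mul_mpolyC /A1 /A2 /A3 /A4 !mpolyCM !mpolyC_nat !exprS.
by ring.
Qed.

Lemma lower_sumX m : lower t (ell ^+ m.+2) =
  ell ^+ m * lin (fun i => m.+2%:R * ((\sum_j t j) - m.+1%:R * t i)).
Proof.
have -> : lin (fun i => m.+2%:R * ((\sum_j t j) - m.+1%:R * t i)) =
    (m.+2%:R * \sum_j t j) *: ell - (m.+2 * m.+1)%:R *: lin t.
  rewrite -scaleNr !linZ linD; apply: eq_bigr => i _; congr (_ *: _).
  by rewrite natrM; ring.
transitivity ((\sum_i t i)%:MP * (m.+2%:R * ell ^+ m.+1) - lin t * ((m.+2 * m.+1)%:R * ell ^+ m)).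
  rewrite lin_mulE !rmorph_sum !mulr_suml -sumrB; apply: eq_bigr => i _ /=.
  rewrite /sqderiv !(mderivM, mderivZ, mderiv_exp, mderiv_lin, mderivC).
  by rewrite -!mul_mpolyC !mpolyC1 !mpolyC_nat natrM; ring.
by rewrite -!mul_mpolyC !mpolyCM !mpolyC_nat !exprS natrM; ring.
Qed.

(** Since t is inverse to a, the difference in the denominator cancels and a symmetric polynomial in
    [t i] and [t j] remains. *)
Lemma mate_coef_affine w x z i j : i != j ->
  mate_coef a (fun l => w * (x - z * t l)) i j = w * (x - z * (t i + t j)).
Proof. by move=> /a_sub ij; rewrite /mate_coef /t; field; rewrite ij !a_neq0. Qed.

Lemma mate_coef_quadratic w x z i j : i != j ->
  mate_coef a (fun l => t l * (w * (x - z * t l))) i j =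
  w * (x * (t i + t j) - z * (t i ^+ 2 + t i * t j + t j ^+ 2)).
Proof. by move=> /a_sub ij; rewrite /mate_coef /t; field; rewrite ij !a_neq0. Qed.

Let t_inj : injective t.
Proof. by move=> i j /invr_inj /a_inj. Qed.

Let ordE (u v : nat) : (u < n)%N -> (v < n)%N -> (inord u == inord v :> 'I_n) = (u == v).
Proof. by move=> hu hv; rewrite -val_eqE /= !inordK. Qed.

(** The square of [lin a] is onto in degree m + 2, so it divides [ell ^+ m.+2]; lowering once makes
    [ell ^+ m * lin c] a multiple of [lin a]. Injectivity would allow cancelling [ell ^+ k], after
    which the matchings leave a vertex free and an exchange gives t_1 = t_2. *)
Lemma not_inj_even m k : n = (2 * m.+1)%N -> (0 < k <= m)%N ->
  ~ inj_mod (@in_ideal K n k) a m.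
Proof.
move=> nm /andP[k0 km] inja.
have hell j : ell ^+ j \is j.-homog.
  by rewrite -[X in X.-homog]mul1n; apply/dhomogMn/lin_homog.
have [||u hu sq] := lin_surj charK0 ta (v := ell ^+ m.+2) (d := m) (k := 2).
- by rewrite addn2.
- by rewrite -/n nm; lia.
have [u' hu' eu'] := lower_linX_multiple ta 1 hu.
have := in_squares_lower t sq; rewrite linearB /= eu' lower_sumX expr1.
set c := fun i : 'I_n => m.+2%:R * _.
have -> : ell ^+ m * lin c = ell ^+ k * (ell ^+ (m - k) * lin c).
  by rewrite mulrA -exprD subnKC.
case/(inj_mod_cancel _ _ inja hu'); first exact: km.
- by rewrite nm; lia.
- by rewrite subSn // -addn1; apply: dhomogM => //; apply: lin_homog.
move=> f' sq'.
have Nn : (2 * (m - k).+1 < n)%N by rewrite nm; lia.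
have ex := match_exchange Nn (fun s => match_sum charK0 a_inj s (ltnW Nn) sq').
have : mate_coef a c (inord 0) (inord 1) = mate_coef a c (inord 0) (inord 2).
  by apply: ex; rewrite ?ordE // -/n nm; lia.
rewrite !mate_coef_affine ?ordE // ?nm; [|lia..].
move/(mulfI _); rewrite natf_eq0 // => /(_ isT) /addrI /oppr_inj /(mulfI _).
rewrite natf_eq0 // => /(_ isT) /addrI /t_inj /eqP.
by rewrite ordE // nm; lia.
Qed.

Lemma mate_coef_inv i j : i != j -> mate_coef a t i j = t i + t j.
Proof. by move=> /a_sub ij; rewrite /mate_coef /t; field; rewrite ij !a_neq0. Qed.

Lemma top_match_lin2 N s (c d : 'I_n -> K) : (2 * N.+2 <= n)%N ->
  (match_contract a N.+2 s (ell ^+ N * (lin c * lin d)))@_(ones N.+2) =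
  N`!%:R * ((\sum_(p < N.+2) mate_coef a c (mate1 s p) (mate2 s p)) *
            (\sum_(p < N.+2) mate_coef a d (mate1 s p) (mate2 s p))
    - \sum_(p < N.+2)
        mate_coef a c (mate1 s p) (mate2 s p) * mate_coef a d (mate1 s p) (mate2 s p)).
Proof.
move=> Nn; rewrite !rmorphM rmorphXn /= match_contract_sum // !match_contract_lin.
by rewrite mulrC -mulrA top_lin2.
Qed.

Lemma match_sum_swap N (H : 'I_n -> 'I_n -> K) : (2 * N.+2 <= n)%N ->
  let s := tperm (inord 1) (inord 2) in
  \sum_(p < N.+2) H (mate1 1 p) (mate2 1 p) =
  \sum_(p < N.+2) H (mate1 s p) (mate2 s p)
  + (H (inord 0) (inord 1) + H (inord 2) (inord 3) - H (inord 0) (inord 2) - H (inord 1) (inord 3)).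
Proof.
move=> Nn s; rewrite !big_ord_recl.
have -> : \sum_(i < N) H (mate1 s (lift ord0 (lift ord0 i))) (mate2 s (lift ord0 (lift ord0 i))) =
    \sum_(i < N) H (mate1 1 (lift ord0 (lift ord0 i))) (mate2 1 (lift ord0 (lift ord0 i))).
  apply: eq_bigr => p _; rewrite /mate1 /mate2 !perm1 !tpermD ?ordE //;
    have := ltn_ord p; by rewrite /= /bump /=; lia.
rewrite /mate1 /mate2 !perm1 /=.
have -> : (2 * bump 0 0 = 2)%N by [].
rewrite tpermL tpermR !tpermD ?ordE //; try lia.
by ring.
Qed.

(** As in the even case, but starting from a cube of [lin a] dividing [ell ^+ m.+4] and lowering
    twice, so that the cofactor Q is quadratic. Two matchings that differ in two pairs give
    incompatible values. *)
Lemma not_inj_odd m k : n = (2 * m.+2 + 1)%N -> (0 < k <= m)%N ->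
  ~ inj_mod (@in_ideal K n k) a m.+1.
Proof.
move=> nm /andP[k0 km] inja.
have hell j : ell ^+ j \is j.-homog.
  by rewrite -[X in X.-homog]mul1n; apply/dhomogMn/lin_homog.
have hlin2 (c d : 'I_n -> K) : lin c * lin d \is 2.-homog.
  by rewrite -[2%N]/(1 + 1)%N; apply: dhomogM; apply: lin_homog.
have [||u hu sq] := lin_surj charK0 ta (v := ell ^+ m.+4) (d := m.+1) (k := 3).
- by rewrite addn3.
- by rewrite -/n nm; lia.
have [u1 hu1 eu1] := lower_linX_multiple ta 2 hu.
have [u2 hu2 eu2] := lower_linX_multiple ta 1 hu1.
have := in_squares_lower t (in_squares_lower t sq).
rewrite linearB /= eu1 lower_sumX linearB /= eu2 expr1.
set w := m.+4%:R; set x := \sum_j t j; set z := m.+3%:R.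
set c := fun i : 'I_n => w * (x - z * t i).
rewrite lower_sumX_lin; set Q := _ + _ - (_ + _).
have -> : ell ^+ m * Q = ell ^+ k * (ell ^+ (m - k) * Q) by rewrite mulrA -exprD subnKC.
case/(inj_mod_cancel _ _ inja hu2); first by rewrite ltnW.
- by rewrite nm; lia.
- rewrite 2?subSn ?leqW // -addn2; apply: dhomogM => //.
  by apply: rpredB; apply: rpredD; apply: rpredZ; apply: hlin2.
move=> f' sq'; pose N := (m - k)%N.
have Nn : (2 * N.+2 <= n)%N by rewrite nm /N; lia.
pose S1 s := \sum_(p < N.+2) (t (mate1 s p) + t (mate2 s p)).
pose S2 s := \sum_(p < N.+2) (t (mate1 s p) + t (mate2 s p)) ^+ 2.
pose S3 s := \sum_(p < N.+2)
  (t (mate1 s p) ^+ 2 + t (mate1 s p) * t (mate2 s p) + t (mate2 s p) ^+ 2).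
pose M : K := N.+2%:R; pose y := \sum_i t i * c i.
(* The top coefficient, up to (m - k)!, of the contraction of ell ^+ N * Q. *)
pose V s := (m.+2%:R * x) * (M * (w * (x * M - z * S1 s)) - w * (x * M - z * S1 s))
  + y * (M * M - M)
  - ((m.+2 * m.+1)%:R * (S1 s * (w * (x * M - z * S1 s)) - w * (x * S1 s - z * S2 s))
     + (2 * m.+2)%:R * (M * (w * (x * S1 s - z * S3 s)) - w * (x * S1 s - z * S3 s))).
have V0 s : V s = 0.
  have mne (p : 'I_N.+2) : mate1 s p != mate2 s p by apply: mate_neq.
  have sumE (H G : 'I_n -> 'I_n -> K) : (forall i j, i != j -> H i j = G i j) ->
      \sum_(p < N.+2) H (mate1 s p) (mate2 s p) = \sum_(p < N.+2) G (mate1 s p) (mate2 s p).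
    by move=> HG; apply: eq_bigr => p _; apply: HG.
  have sum1 : \sum_(p < N.+2) mate_coef a (fun=> 1) (mate1 s p) (mate2 s p) = M.
    rewrite (sumE _ (fun _ _ => 1)) => [|i j ij]; last exact: mate_coef_const.
    by rewrite sumr_const card_ord.
  have sumt : \sum_(p < N.+2) mate_coef a t (mate1 s p) (mate2 s p) = S1 s.
    by apply: (sumE _ (fun i j => t i + t j)) => i j ij; apply: mate_coef_inv.
  have sumc : \sum_(p < N.+2) mate_coef a c (mate1 s p) (mate2 s p) = w * (x * M - z * S1 s).
    rewrite (sumE _ (fun i j => w * x - w * z * (t i + t j))) => [|i j ij]; last first.
      by rewrite mate_coef_affine //; ring.
    by rewrite sumrB -[X in _ - X]mulr_sumr sumr_const card_ord -/(S1 s) -mulr_natr -/M; ring.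
  have sumtc : \sum_(p < N.+2) mate_coef a (fun i => t i * c i) (mate1 s p) (mate2 s p) =
      w * (x * S1 s - z * S3 s).
    rewrite (sumE _ (fun i j => w * x * (t i + t j) - w * z * (t i ^+ 2 + t i * t j + t j ^+ 2)));
      last by move=> i j ij; rewrite mate_coef_quadratic //; ring.
    rewrite sumrB -[X in _ - X]mulr_sumr -[X in X - _]mulr_sumr -/(S1 s) -/(S3 s); ring.
  have sumt_c : \sum_(p < N.+2) mate_coef a t (mate1 s p) (mate2 s p)
      * mate_coef a c (mate1 s p) (mate2 s p) = w * (x * S1 s - z * S2 s).
    rewrite (sumE (fun i j => mate_coef a t i j * mate_coef a c i j)
      (fun i j => w * x * (t i + t j) - w * z * (t i + t j) ^+ 2));
      last by move=> i j ij; rewrite mate_coef_inv // mate_coef_affine //; ring.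
    rewrite sumrB -[X in _ - X]mulr_sumr -[X in X - _]mulr_sumr -/(S1 s) -/(S2 s); ring.
  have sum1l (d : 'I_n -> K) : \sum_(p < N.+2) mate_coef a (fun=> 1) (mate1 s p) (mate2 s p)
      * mate_coef a d (mate1 s p) (mate2 s p)
      = \sum_(p < N.+2) mate_coef a d (mate1 s p) (mate2 s p).
    by apply: eq_bigr => p _; rewrite mate_coef_const // mul1r.
  have := match_lin_ideal s Nn sq'; rewrite -/N /Q.
  rewrite mulrBr !mulrDr -!scalerAr rmorphB !rmorphD /=.
  rewrite /match_contract !contractZ -/(match_contract a N.+2 s).
  rewrite mcoeffB !mcoeffD !mcoeffZ !top_match_lin2 // !sum1l sum1 sumt sumc sumtc sumt_c.
  move=> e; apply: (mulfI (x := N`!%:R)); first by rewrite natf_eq0 // -lt0n fact_gt0.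
  by rewrite mulr0 -[RHS]e -/x -/y /V; ring.
have Vswap := V0 (tperm (inord 1) (inord 2)); have V1 := V0 1%g.
have e1 := match_sum_swap (fun i j => t i + t j) Nn.
have e2 := match_sum_swap (fun i j => (t i + t j) ^+ 2) Nn.
have e3 := match_sum_swap (fun i j => t i ^+ 2 + t i * t j + t j ^+ 2) Nn.
(* The exchange 01|23 -> 02|13 of partners preserves S1 and changes S2 and S3 by
   2 and 1 times (t0 - t3) (t1 - t2). *)
move: V1; rewrite /V [S1 1%g]e1 [S2 1%g]e2 [S3 1%g]e3.
rewrite -/(S1 _) -/(S2 _) -/(S3 _) -[RHS]Vswap /V.
set s1 := S1 _; set s2 := S2 _; set s3 := S3 _.
set t0 := t (inord 0); set t1 := t (inord 1); set t2 := t (inord 2); set t3 := t (inord 3).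
move/eqP; rewrite -subr_eq0 => /eqP E.
(* The factor [m.+2%:R - M] equals k, so it is nonzero because k is positive. *)
have : 2%:R * (m.+2%:R * (m.+3%:R * (m.+4%:R * ((m.+2%:R - M) * ((t0 - t3) * (t1 - t2)))))) = 0 :> K.
  rewrite -[RHS]oppr0 -E /w /z !natrM -!natr1; ring.
have tne (i j : nat) : (i < 4)%N -> (j < 4)%N -> i != j -> t (inord i) - t (inord j) != 0.
  by move=> hi hj ij; rewrite subr_eq0 (inj_eq t_inj) ordE // nm; lia.
apply/eqP; rewrite !mulf_neq0 ?natf_eq0 ?tne //.
by rewrite /M natrB_neq0 // /N; lia.
Qed.
End Injectivity.

(** * The quotient algebra *)

Section Criterion.
Variables (K : fieldType) (n' k : nat).
Hypothesis charK0 : [pchar K] =i pred0.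
Hypothesis k2 : (2 <= k)%N.
Let n := n'.+1.
Implicit Types (p q z : {mpoly K[n]}) (a b : 'I_n -> K) (m d : nat).

Lemma not_surj_mod h m a : n = (h + m)%N -> (m <= h <= m.+1)%N -> (0 < m)%N ->
  injective a -> (forall i, a i != 0) -> ~ surj_mod (@in_ideal K n k) a m.-1.
Proof.
move=> e hm m_gt0 a_inj a_neq0 surja.
have [z hz nz] : exists2 z : {mpoly K[n]}, z \is m.-homog &
    forall p q, ~ in_squares (z - lin a * p - lin (fun=> 1) ^+ 2 * q).
  move: a a_inj a_neq0 {surja}; rewrite e => a a_inj a_neq0.
  exact: not_surjective.
have [|p _ [q sq]] := surja z; first by rewrite prednK.
apply: (nz p (lin (fun=> 1) ^+ (k - 2) * q)).
by rewrite mulrA -exprD subnKC.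
Qed.

Let nats (i : 'I_n) : K := i.+1%:R.

Let nats_inj : injective nats.
Proof.
move=> i j; wlog ij : i j / (i <= j)%N.
  by move=> hw; case/orP: (leq_total i j) => [/hw //|/hw ji e]; apply/esym/ji.
move/eqP; rewrite /nats eq_sym -subr_eq0 -natrB // natf_eq0 // subSS subn_eq0 => ji.
by apply/val_inj/eqP; rewrite eqn_leq ij.
Qed.

Let nats_neq0 i : nats i != 0. Proof. by rewrite natf_eq0. Qed.

(** Each coordinate, and each difference of two, is a polynomial in s that is nonzero at s = 1,
    where the line passes through [nats]. Some s avoids all their roots and those of P. *)
Lemma generic_line a (P : {poly K}) : P != 0 -> exists s,
  [/\ P.[s] != 0, injective (fun i => a i + s * (nats i - a i))
    & forall i, a i + s * (nats i - a i) != 0].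
Proof.
move=> P0; pose R i : {poly K} := (a i)%:P + (nats i - a i) *: 'X.
have R1 i : (R i).[1] = nats i by rewrite hornerD hornerC hornerZ hornerX mulr1 addrC subrK.
have Rs i s : (R i).[s] = a i + s * (nats i - a i) by rewrite hornerD hornerC hornerZ hornerX [s * _]mulrC.
pose Q := P * (\prod_i R i) * \prod_i \prod_(j | j != i) (R i - R j).
have [|s] := poly_nonroot charK0 (P := Q).
  have neq0 (S : {poly K}) : S.[1] != 0 -> S != 0 by apply: contraNneq => ->; rewrite horner0.
  rewrite !mulf_neq0 //; apply/prodf_neq0 => i _; first by apply: neq0; rewrite R1.
  apply/prodf_neq0 => j ji; apply: neq0.
  by rewrite hornerD hornerN !R1 subr_eq0 (inj_eq nats_inj) eq_sym.
rewrite !hornerM !horner_prod !mulf_eq0 !negb_or => /andP[/andP[Ps /prodf_neq0 hR] /prodf_neq0 hRR].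
exists s; split=> // [i j e|i]; last by rewrite -Rs; apply: hR.
apply/eqP; apply: contraT; rewrite eq_sym => ij.
have := hRR i isT; rewrite horner_prod => /prodf_neq0/(_ j ij).
by rewrite hornerD hornerN !Rs e subrr eqxx.
Qed.

Lemma wlp_criterion :
  (exists a, forall d, inj_mod (@in_ideal K n k) a d \/ surj_mod (@in_ideal K n k) a d) <->
  (if odd n then n <= 2 * k + 3 else n <= 2 * k)%N.
Proof.
split=> [[a ha]|cond].
  apply: boolp.contrapT => /negP ncond.
  (* The degree m - 1, just below the middle, is where both properties fail for distinct nonzero
     coordinates. *)
  pose m := n./2.
  have nE : n = (odd n + 2 * m)%N by rewrite -[LHS]odd_double_half -mul2n.
  have m_gt0 : (0 < m)%N by move: ncond nE; case: (odd n) => /=; lia.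
  have not_both b : injective b -> (forall i, b i != 0) ->
      ~ inj_mod (@in_ideal K n k) b m.-1 /\ ~ surj_mod (@in_ideal K n k) b m.-1.
    move=> b_inj b_neq0; split; last first.
      by apply: (@not_surj_mod (odd n + m)) => //; [rewrite {1}nE; lia|case: (odd n); lia].
    case: (boolP (odd n)) ncond nE => on ncond nE.
      have -> : m.-1 = (m - 2).+1 by lia.
      by apply: (not_inj_odd charK0 b_inj b_neq0); rewrite -/n ?nE; lia.
    by apply: (not_inj_even charK0 b_inj b_neq0); rewrite -/n ?nE; lia.
  have J0 := @in_ideal0 K n k; have JD := @in_idealD K n k; have JM := @in_idealM K n k.
  case: (ha m.-1) => h.
    have [P P0 hP] := generic_inj_mod J0 JD JM (fun i => nats i - a i) h.
    have [s [Ps s_inj s_neq0]] := generic_line a P0.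
    by have [ni _] := not_both _ s_inj s_neq0; apply/ni/hP.
  have [P P0 hP] := generic_surj_mod J0 JD JM (fun i => nats i - a i) h.
  have [s [Ps s_inj s_neq0]] := generic_line a P0.
  by have [_ ns] := not_both _ s_inj s_neq0; apply/ns/hP.
(* Below the middle, [cond] leaves exactly the three cases of [inj_mod_low]. *)
exists nats => d; have [nd|dn] := leqP n (2 * d + 1).
  by right; apply: surj_mod_high.
left; apply: inj_mod_low => //; rewrite -/n; first exact: ltnW.
have := odd_double_half n; move: cond; case: (odd n) => /=; lia.
Qed.
End Criterion.

(** * Linear changes of variables *)

Section Substitution.
Variables (K : fieldType) (n : nat).
Implicit Types (p q : {mpoly K[n]}) (T : 'M[K]_n) (c : 'I_n -> K).

Definition lin_subst T p : {mpoly K[n]} := mmap (mpolyC n (R := K)) (fun i => lin (T i)) p.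

HB.instance Definition _ T := GRing.RMorphism.copy (lin_subst T)
  (mmap (mpolyC n (R := K)) (fun i => lin (T i))).

Lemma lin_substZ T x p : lin_subst T (x *: p) = x *: lin_subst T p.
Proof. by rewrite /lin_subst mmapZ mul_mpolyC. Qed.

Lemma lin_substXU T i : lin_subst T 'X_i = lin (T i).
Proof. by rewrite /lin_subst mmapX mmap1U. Qed.

Lemma lin_subst_lin T c : lin_subst T (lin c) = lin (fun j => \sum_i c i * T i j).
Proof.
rewrite /lin raddf_sum /=; under eq_bigr do rewrite lin_substZ lin_substXU /lin scaler_sumr.
rewrite exchange_big; apply: eq_bigr => j _ /=; rewrite scaler_suml.
by apply: eq_bigr => i _; rewrite scalerA.
Qed.

Lemma lin_subst_homog T p d : p \is d.-homog -> lin_subst T p \is d.-homog.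
Proof.
move=> hp; rewrite [p]mpolyE raddf_sum big_seq; apply: rpred_sum => mu pmu /=.
rewrite lin_substZ; apply: rpredZ; rewrite /lin_subst mmapX /mmap1.
rewrite -(dhomog_mf hp pmu) /= mdegE; apply: homog_prod_ord => i.
by rewrite -[X in X.-homog]mul1n; apply/dhomogMn/lin_homog.
Qed.

Lemma lin_substK T T' : T *m T' = 1%:M -> cancel (lin_subst T) (lin_subst T').
Proof.
move=> TT' p; transitivity (\sum_(mu <- msupp p) p@_mu *: 'X_[mu]); last by rewrite -mpolyE.
rewrite {1}[p]mpolyE (rmorph_sum (lin_subst T)) (rmorph_sum (lin_subst T')).
apply: eq_bigr => mu _ /=.
rewrite !lin_substZ mpolyXE_id !rmorph_prod; congr (_ *: _); apply: eq_bigr => i _ /=.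
rewrite !rmorphXn /= lin_substXU lin_subst_lin; congr (_ ^+ _).
have TE j : \sum_l T i l * T' l j = (i == j)%:R.
  by have := congr1 (fun A : 'M_n => A i j) TT'; rewrite !mxE.
rewrite /lin (bigD1 i) //= TE eqxx scale1r big1 ?addr0 // => j ji.
by rewrite TE eq_sym (negPf ji) scale0r.
Qed.
End Substitution.

(** * Transport to the quotient by powers of general linear forms *)

Section Transfer.
Variables (K : fieldType) (n k : nat) (L : 'M[K]_(n.+1, n)) (T T' : 'M[K]_n) (c : 'I_n -> K).
Let wid (i : 'I_n) : 'I_n.+1 := widen_ord (leqnSn n) i.
Hypotheses (k2 : (2 <= k)%N) (TT' : T *m T' = 1%:M) (T'T : T' *m T = 1%:M).
Hypotheses (c_neq0 : forall i, c i != 0) (TE : forall i j, T i j = c i * L (wid i) j).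
Hypothesis T_sum : forall j, \sum_i T i j = L ord_max j.
Implicit Types p q : {mpoly K[n]}.

Local Notation ell := (lin (fun _ : 'I_n => 1 : K)).

Let subst_X i : lin_subst T 'X_i = c i *: lform L (wid i).
Proof.
rewrite lin_substXU -[lform _ _]/(lin (L (wid i))) linZ.
by apply: eq_bigr => j _; rewrite TE.
Qed.

Let subst_ell : lin_subst T ell = lform L ord_max.
Proof.
rewrite lin_subst_lin; apply: eq_bigr => j _; rewrite -T_sum; congr (_ *: _).
by apply: eq_bigr => i _; rewrite mul1r.
Qed.

Let subst_lform i : lin_subst T' (lform L (wid i)) = (c i)^-1 *: 'X_i.
Proof.
apply: (canLR (lin_substK TT')).
by rewrite lin_substZ subst_X scalerA mulVf // scale1r.
Qed.

Let subst_lform_max : lin_subst T' (lform L ord_max) = ell.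
Proof. by rewrite -subst_ell lin_substK. Qed.

Let gens_wid i : gens k L (wid i) = lform L (wid i) ^+ 2.
Proof. by rewrite /gens -val_eqE /= ltn_eqF. Qed.

Let gens_max : gens k L ord_max = lform L ord_max ^+ k.
Proof. by rewrite /gens eqxx. Qed.

Lemma gen_by_subst p : p \in gen_by (gens k L) <-> in_ideal k (lin_subst T' p).
Proof.
split=> [/gen_byP[d ->]|[q /in_squaresP[d ed]]].
  rewrite big_ord_recr /= -/wid gens_max rmorphD rmorphM rmorphXn /= subst_lform_max.
  exists (lin_subst T' (d ord_max)); rewrite [ell ^+ k * _]mulrC addrK rmorph_sum.
  apply: in_squares_sum => i /=; rewrite -/(wid i) gens_wid rmorphM rmorphXn /= subst_lform.
  by rewrite exprZn -scalerAr; apply/in_squaresZ/in_squaresM/in_squaresXX.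
apply/gen_byP.
have := congr1 (lin_subst T) ed; rewrite rmorphB rmorphM rmorphXn /= subst_ell lin_substK //.
move/(canRL (subrK _)) => ->.
(* The square of the variable j is sent to [c j ^+ 2] times the square of the j-th form, and the
   cofactor absorbs this scalar. *)
exists (fun i =>
  if unlift ord_max i is Some j then c j ^+ 2 *: lin_subst T (d j) else lin_subst T q).
rewrite big_ord_recr /= gens_max unlift_none mulrC rmorph_sum; congr (_ + _).
  apply: eq_bigr => i _; rewrite -/(wid i) gens_wid rmorphM rmorphXn /= subst_X.
  have -> : wid i = lift ord_max i by apply: val_inj; rewrite /= /bump leqNgt ltn_ord.
  by rewrite liftK exprZn -scalerAr -scalerAl.
Qed.

Let Qt := quot_alg k2 L.
Let proj p : Qt := \pi_({ideal_quot (gen_ideal (gens_proper L k2))})%qT p.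

Let proj_eq p q : proj p = proj q <-> in_ideal k (lin_subst T' (p - q)).
Proof.
rewrite -gen_by_subst; split=> [/eqP|] h; first by rewrite -Quotient.idealrBE in h.
by apply/eqP; rewrite -Quotient.idealrBE.
Qed.

Let projD p q : proj (p + q) = proj p + proj q.
Proof. by rewrite /proj !piE. Qed.

Let projM p q : proj (p * q) = proj p * proj q.
Proof. by rewrite /proj !piE. Qed.

Let proj_onto x : exists p, x = proj p.
Proof. by exists (repr x); rewrite /proj reprK. Qed.

Lemma weak_Lefschetz_quotE : weak_Lefschetz (@quot_gr K n k k2 L) <->
  exists a, forall d, inj_mod (@in_ideal K n k) a d \/ surj_mod (@in_ideal K n k) a d.
Proof.
split=> [[_ [lam hlam ->]] wl|[a ha]].
  have [a ea] := homog1_lin (lin_subst_homog T' hlam).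
  exists a => d; case: (wl d) => h; [left=> p hp hap|right=> z hz].
    have : proj (lin_subst T p) = proj 0.
      apply: h; [by exists (lin_subst T p) => //; apply: lin_subst_homog| |].
        by exists 0 => //; apply: dhomog0.
      rewrite -!projM; apply/proj_eq.
      by rewrite mulr0 subr0 rmorphM /= ea lin_substK.
    by rewrite proj_eq subr0 lin_substK.
  have [|_ [p hp ->]] := h (proj (lin_subst T z)).
    by exists (lin_subst T z) => //; apply: lin_subst_homog.
  rewrite -projM => /esym/proj_eq; rewrite rmorphB rmorphM /= lin_substK // ea => hz'.
  by exists (lin_subst T' p) => //; apply: lin_subst_homog.
exists (proj (lin_subst T (lin a))).
  by exists (lin_subst T (lin a)) => //; apply/lin_subst_homog/lin_homog.
move=> d; case: (ha d) => h; [left|right].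
  move=> _ _ [p hp ->] [q hq ->]; rewrite -!projM => /proj_eq.
  rewrite -mulrBr rmorphM /= lin_substK // => /h hpq.
  by apply/proj_eq/hpq; apply/lin_subst_homog/rpredB.
move=> _ [z hz ->]; have [p hp hJ] := h _ (lin_subst_homog T' hz).
exists (proj (lin_subst T p)); first by exists (lin_subst T p) => //; apply: lin_subst_homog.
rewrite -projM; apply/esym/proj_eq.
by rewrite rmorphB rmorphM /= !lin_substK.
Qed.

(** Monomials of degree at most n include all squarefree ones, so they span the quotient after the
    change of variables. A descending chain of ideals becomes a chain of row spaces, constant from
    where the rank is minimal. *)
Lemma quot_artinian : artinian (quot_alg k2 L).
Proof.
move=> J J_ideal J_desc.
pose B := 'X_{1..n < n.+1}; pose N := #|{: B}|.
pose rho (v : 'rV[K]_N) : {mpoly K[n]} := \sum_(mu : B) v 0 (enum_rank mu) *: 'X_[mu].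
have rhoD x u v : rho (x *: u + v) = x *: rho u + rho v.
  rewrite /rho scaler_sumr -big_split; apply: eq_bigr => mu _.
  by rewrite !mxE scalerDl scalerA.
pose theta v := proj (lin_subst T (rho v)).
have theta_onto x : exists v, x = theta v.
  have [p ->] := proj_onto x; exists (\row_i (lin_subst T' p)@_(enum_val i : B)).
  apply/proj_eq; rewrite rmorphB /= lin_substK //; apply: in_squares_ideal => mu hmu.
  have dmu : (mdeg mu < n.+1)%N.
    rewrite ltnS mdegE -[X in (_ <= X)%N]card_ord -sum1_card; apply: leq_sum => i _; exact: hmu.
  rewrite mcoeffB /rho [X in _ - X]raddf_sum [X in _ - X](bigD1 (BMultinom dmu)) //=.
  rewrite [X in _ - (_ + X)]big1 => [|nu ne].
    by rewrite addr0 mcoeffZ mcoeffX eqxx mulr1 mxE enum_rankK subrr.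
  rewrite mcoeffZ mcoeffX; case: eqP => [e|_]; last by rewrite mulr0.
  by case/negP: ne; rewrite -val_eqE /= e.
have thetaD x u v : theta (x *: u + v) = proj (x%:MP) * theta u + theta v.
  by rewrite /theta rhoD rmorphD /= lin_substZ -mul_mpolyC projD projM.
have JD i x u v : J i (theta u) -> J i (theta v) -> J i (theta (x *: u + v)).
  by case: (J_ideal i) => _ hD hM hu hv; rewrite thetaD; apply/hD/hv/hM.
have theta0 : theta 0 = 0.
  apply: (addIr (theta 0)); rewrite add0r.
  have := thetaD 1 0 0; rewrite scale1r addr0 mpolyC1 => e.
  have proj1 : proj 1 = 1 by rewrite /proj piE.
  by rewrite {3}e proj1 mul1r.
have J0 i : J i (theta 0) by rewrite theta0; case: (J_ideal i).
have /boolp.choice[C hC] i := subspace_mx (J0 i) (JD i).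
have C_desc i j : (C (i + j)%N <= C i)%MS.
  elim: j => [|j IHj]; first by rewrite addn0.
  apply: submx_trans IHj; apply/rV_subP => v; rewrite addnS -!hC.
  exact: J_desc.
pose Q r := boolp.asbool (exists i, \rank (C i) = r).
have exQ : exists r, Q r by exists (\rank (C 0%N)); apply/boolp.asboolP; exists 0%N.
case: (ex_minnP exQ) => r /boolp.asboolP[i0 ri0] minr.
exists i0 => i le_i x; have [v ->] := theta_onto x; rewrite !hC.
have sub : (C i <= C i0)%MS by rewrite -(subnKC le_i).
have /mxrank_leqif_sup[_ e] := sub.
have sub' : (C i0 <= C i)%MS.
  by rewrite -e eqn_leq mxrankS //= ri0; apply: minr; apply/boolp.asboolP; exists i.
by split=> h; apply: submx_trans h _.
Qed.
End Transfer.

(** * The open condition on the linear forms *)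

Section GeneralPosition.
Variable n : nat.
Let wid (i : 'I_n) : 'I_n.+1 := widen_ord (leqnSn n) i.

Definition first_rows (R : pzRingType) (A : 'M[R]_(n.+1, n)) : 'M[R]_n :=
  \matrix_(i, j) A (wid i) j.

(* Nonzero when the first n forms are independent and the coordinates of the
   last one in this basis are all nonzero. *)
Definition general_det (R : comNzRingType) (A : 'M[R]_(n.+1, n)) : R :=
  \det (first_rows A) * \prod_i (row ord_max A *m \adj (first_rows A)) 0 i.

Lemma general_det_map (R R' : comNzRingType) (f : {rmorphism R -> R'}) (A : 'M[R]_(n.+1, n)) :
  general_det (map_mx f A) = f (general_det A).
Proof.
rewrite /general_det rmorphM rmorph_prod /= -det_map_mx.
have -> : first_rows (map_mx f A) = map_mx f (first_rows A) by apply/matrixP => i j; rewrite !mxE.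
congr (_ * _); apply: eq_bigr => i _.
by rewrite -map_mx_adj -map_row -map_mxM mxE.
Qed.

Lemma zariski_open_general_det (K : fieldType) :
  zariski_open (fun L : 'M[K]_(n.+1, n) => general_det L != 0).
Proof.
pose X : 'M[{mpoly K[n.+1 * n]}]_(n.+1, n) := \matrix_(i, j) 'X_(mxvec_index i j).
exists (eq (general_det X)) => L.
have eL : general_det L = (general_det X).@[fun i => mxvec L 0 i].
  rewrite -[RHS]general_det_map; congr general_det; apply/matrixP => i j.
  by rewrite !mxE /= mevalXU mxvecE.
by rewrite eL; split=> [|[_ <-]] //; exists (general_det X).
Qed.

(** The witness consists of the n variables and their sum. *)
Lemma general_det_neq0 (K : fieldType) : exists L : 'M[K]_(n.+1, n), general_det L != 0.
Proof.
exists (\matrix_(i, j) if i == ord_max then 1 else (i == wid j)%:R); rewrite /general_det.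
set A := \matrix_(i, j) _; have -> : first_rows A = 1%:M.
  apply/matrixP => i j; rewrite !mxE.
  by rewrite -(inj_eq val_inj (wid i)) /= ltn_eqF.
have -> : \adj 1%:M = 1%:M :> 'M[K]_n by rewrite -[LHS]mul1mx mul_mx_adj det1.
rewrite det1 mul1r mulmx1; apply/prodf_neq0 => i _.
by rewrite !mxE eqxx oner_eq0.
Qed.
End GeneralPosition.

Theorem theorem3p2 (K : fieldType) (charK0 : [pchar K] =i pred0)
    (n k : nat) (n2 : (2 <= n)%N) (k2 : (2 <= k)%N) :
  for_general (fun L : 'M[K]_(n.+1, n) =>
    artinian (quot_alg k2 L) /\
    (weak_Lefschetz (@quot_gr K n k k2 L) <->
       if odd n then (n%:R - 3%:R) / 2%:R <= k%:R :> rat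
       else n%:R / 2%:R <= k%:R :> rat)).
Proof.
exists (fun L => general_det L != 0); split.
- exact: zariski_open_general_det.
- exact: general_det_neq0.
move=> L; rewrite mulf_eq0 negb_or => /andP[detA /prodf_neq0 hprod].
(* These are the coordinates of the last form in the basis of the others; scaling the i-th form by
   [c i] turns the last form into the sum of the scaled ones. *)
pose A := first_rows L; pose c i := (row ord_max L *m invmx A) 0 i.
have uA : A \in unitmx by rewrite unitmxE unitfE.
have c_neq0 i : c i != 0.
  by rewrite /c /invmx uA -scalemxAr mxE mulf_neq0 ?invr_eq0 // hprod.
pose T : 'M_n := \matrix_(i, j) (c i * A i j).
have uT : T \in unitmx.
  have -> : T = diag_mx (\row_i c i) *m A.
    by apply/matrixP => i j; rewrite mul_diag_mx !mxE.
  rewrite unitmx_mul uA andbT unitmxE unitfE det_diag.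
  by apply/prodf_neq0 => i _; rewrite mxE.
have TE i j : T i j = c i * L (widen_ord (leqnSn n) i) j by rewrite !mxE.
have T_sum j : \sum_i T i j = L ord_max j.
  transitivity ((row ord_max L *m invmx A *m A) 0 j); last by rewrite mulmxKV // mxE.
  by rewrite mxE; apply: eq_bigr => i _; rewrite mxE.
have TT' := mulmxV uT; have T'T := mulVmx uT.
split; first exact: (quot_artinian TT' T'T c_neq0 TE T_sum).
rewrite (weak_Lefschetz_quotE k2 TT' T'T c_neq0 TE T_sum).
case: n n2 L detA hprod {A c uA c_neq0 T uT TE T_sum TT' T'T} => // n' _ _ _ _.
rewrite (wlp_criterion n' charK0 k2).
by case: ifP => _; rewrite ler_pdivrMr ?ltr0n // -natrM ?lerBlDr -?natrD ler_nat mulnC.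
Qed.
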